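(* Let $W$ be a mean zero random variable with finite, nonzero variance $\sigma^2$, and let $W^*$ have the $W$-zero biased distribution. Then: 1. The mean zero normal is the unique fixed point of the zero bias transformation; that is, $W^*$ and $W$ have the same distribution if and only if $W\sim\mathcal{N}(0,\sigma^2)$. 2. The distribution of $W^*$ is unimodal about zero and (absolutely) continuous with density function $p(w)=\sigma^{-2}E[W\mathbf{1}(W>w)]$. The support of $W^*$ is the closed convex hull of the support of $W$, and $W^*$ is bounded whenever $W$ is bounded. 3. The zero bias transformation preserves symmetry: if the distribution of $W$ is symmetric about $0$, so is that of $W^*$. 4. For every integer $n\ge 1$ such that $EW^{n+2}$ exists, $\sigma^2E(W^* )^{n}=EW^{n+2}/(n+1)$. 5. Let $X_1,\ldots,X_n$ be independent mean zero random variables with $EX_i^2=\sigma_i^2<\infty$, and suppose that $W=X_1+\cdots+X_n$, so $EW^2=\sigma^2=\sum_{i}\sigma_i^2>0$. For each $i$ with $\sigma_i^2>0$ let $X_i^*$ have the $X_i$-zero biased distribution and be independent of $(X_j)_{j\ne i}$. Let $I$ be a random index independent of all the $X_j$ and $X_j^*$ such that $P(I=i)=\sigma_i^2/\sigma^2$, and let $W_i=W-X_i=\sum_{j\neq i}X_j$. Then $W_I+X_I^*$ has the $W$-zero biased distribution. 6. Let $X$ be mean zero with finite nonzero variance $\sigma_X^2$ and distribution $dF$. Let $(\hat{X}',\hat{X}'')$ have distribution $$d\hat{F}(\hat{x}',\hat{x}'')=\frac{(\hat{x}'-\hat{x}'')^2}{2\sigma_X^2}\,dF(\hat{x}')\,dF(\hat{x}'').$$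 Then, with $U$ a uniform variate on $[0,1]$ independent of $(\hat X',\hat X'')$, the variable $U\hat{X}'+(1-U)\hat{X}''$ has the $X$-zero biased distribution.
   Context: For a mean zero random variable $W$ with finite, nonzero variance $\sigma^2$, a random variable $W^*$ has the $W$-zero biased distribution if $E[Wf(W)]=\sigma^2E[f'(W^* )]$ for all differentiable $f:\mathbb{R}\to\mathbb{R}$ for which both expectations exist (are absolutely convergent). This distribution exists and is unique; the map taking the distribution of $W$ to that of $W^*$ is the zero bias transformation. A distribution with density $p$ is unimodal about zero if $p$ is nondecreasing on $(-\infty,0)$ and nonincreasing on $(0,\infty)$. *)

(* Defs.v *)
From mathcomp Require Import all_boot all_order all_algebra.
From mathcomp Require Import all_classical all_reals all_analysis.

Set Implicit Arguments.
Unset Strict Implicit.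
Unset Printing Implicit Defensive.

Import Order.TTheory GRing.Theory Num.Theory.
Import numFieldNormedType.Exports.

Local Open Scope classical_set_scope.
Local Open Scope ring_scope.

Section laws.
Context {R : realType}.
Implicit Types mu nu : set (measurableTypeR R) -> \bar R.

(* Laws are compared on measurable sets only: on other sets the values of
   these set functions carry no meaning. *)
Definition same_law mu nu :=
  forall A : set (measurableTypeR R), measurable A -> mu A = nu A.

Definition symmetric_law mu :=
  forall A : set (measurableTypeR R), measurable A ->
    mu [set x : R | A (- x)] = mu A.

Definition has_density mu (p : R -> R) :=
  [/\ measurable_fun [set: R] p, (forall x, 0 <= p x) &
      forall A : set (measurableTypeR R), measurable A ->
        mu A = (\int[lebesgue_measure]_(x in A) (p x)%:E)%E].

Definition unimodal_about0 (p : R -> R) :=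
  {in `]-oo, 0[ &, {homo p : x y / x <= y}} /\
  {in `]0, +oo[ &, {homo p : x y /~ x <= y}}.

Definition law_support mu : set R :=
  [set x | forall U : set R, open U -> U x -> (0 < mu U)%E].

(* [R^o] is [R] seen as a module over itself, as [convex_set] requires. *)
Definition closed_convex_hull (A : set R) : set R :=
  smallest [set C : set R | closed C /\ convex_set (C : set R^o)] A.

End laws.

Section bounded.
Context d (T : measurableType d) (R : realType).

Definition as_bounded (P : probability T R) (X : T -> R) :=
  exists M : R, \forall w \ae P, `|X w| <= M.

End bounded.

Section zero_bias.
Context d d' (T : measurableType d) (T' : measurableType d') (R : realType).

(* [W] and [Ws] may live on different probability spaces. The defining identity
   is imposed for every everywhere differentiable [f] such that both
   expectations are absolutely convergent. *)
Definition zero_biased (P : probability T R) (W : T -> R)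
    (Q : probability T' R) (Ws : T' -> R) :=
  measurable_fun [set: T'] Ws /\
  forall f : R -> R, (forall x, derivable f x 1) ->
    P.-integrable [set: T] (fun w => (W w * f (W w))%:E) ->
    Q.-integrable [set: T'] (fun w => (derive1 f (Ws w))%:E) ->
    ('E_P[fun w => (W w * f (W w))%R] =
     'V_P[W] * 'E_Q[fun w => derive1 f (Ws w)])%E.

End zero_bias.

Section zero_bias_density.
Context d (T : measurableType d) (R : realType).

Definition zero_bias_density (P : probability T R) (W : T -> R) (w : R) : R :=
  (fine 'V_P[W]%E)^-1 *
  fine 'E_P[fun x => (W x * \1_[set y | (w < W y)%R] x)%R]%E.

End zero_bias_density.

Section independence.
Context d (T : measurableType d) (R : realType) (P : probability T R).

Definition independent_events (F G : set (set T)) :=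
  forall A B, F A -> G B -> P (A `&` B) = (P A * P B)%E.

Definition mutually_independent (I : finType) (X : I -> T -> R) :=
  forall (J : {set I}) (A : I -> set R), (forall i, measurable (A i)) ->
    P (\bigcap_(i in [set` J]) (X i @^-1` A i)) =
    (\prod_(i in J) P (X i @^-1` A i))%E.

Definition generated_by d' (U : measurableType d') (V : T -> U) : set (set T) :=
  preimage_set_system [set: T] V measurable.

Definition family_generated_by (I : Type) (D : set I) (X : I -> T -> R) :
    set (set T) :=
  <<s \bigcup_(i in D) generated_by (X i) >>.

End independence.

(* Main.v *)
Require Import Defs.
From HB Require Import structures.
From mathcomp Require Import all_boot all_order all_algebra.
From mathcomp Require Import all_classical all_reals all_analysis.
From mathcomp Require Import measurable_realfun ring lra.

(** Everything rests on one kernel.  With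
      k(x,t) = x ([t < x] - [t < 0]) >= 0,
    which is |x| when t lies between 0 and x and 0 otherwise, integration in t
    gives  int k(x,t) f'(t) dt = x (f x - f 0),  while the expectation in W,
    because E W = 0, is  E k(W,t) = E[W 1(W > t)] = sigma^2 p(t),  p being the
    zero bias density.  Fubini's theorem turns these two facts into
      E[W f(W)] = sigma^2 int f'(t) p(t) dt,
    so a variable with density p has the W-zero biased law.  Conversely the
    defining identity for the primitives of piecewise linear ramps determines
    the law of W^* on the half-lines, hence everywhere
    ([zero_biased_has_density], [has_density_zero_biased]).  Being zero biased
    is thus the same as having density p, and it is enough to test it on
    functions whose derivative is continuous with values in [0, 1].

    The identity is required for every differentiable f such that both
    expectations converge, so f' may be neither continuous nor locally bounded.
    Two points need care.  First, f x - f 0 must be recovered from f' when f'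
    is merely integrable between 0 and x ([integrable_derive1_FTC2]).  Second,
    for a sum W = X_1 + ... + X_n the convergence of E[W f(W)] does not give
    that of E[X_i f(W)]; this is why the laws in the last two properties are
    first identified through test functions, for which everything converges,
    and the general identity is then read off from the density.

    The properties follow.  The kernel is monotone in t on each side of 0, which
    gives unimodality, and p(t) > 0 forces W to charge both sides of t, which
    identifies the support as the closed convex hull
    ([zero_biased_support]).  If W is symmetric then - W^* is also
    zero biased for W, hence has the same density
    ([zero_biased_symmetric]).  Taking f(x) = x^(n+1) / (n+1) gives the moments
    ([zero_biased_moment]); that W^* has an n-th moment comes from
    E k(W,t) = sigma^2 p(t).  For W normal, p is again the normal density
    because - sigma^2 phi is a primitive of x phi; if W itself has density p,
    then sigma^2 p(t) is the integral of x p(x) over x > t, so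
    p' = - t p / sigma^2 and p is normal
    ([zero_bias_density_normal], [zero_bias_density_fixed_normal]).

    For independent summands, conditioning on W_i = W - X_i gives
    E[X_i f(W_i + X_i)] = sigma_i^2 E[f'(W_i + Y_i)] for Y_i zero biased for X_i
    and independent of the other summands; summing over i is the same as drawing
    the index with probabilities sigma_i^2 / sigma^2
    ([random_replacement_zero_biased]).  For the square bias construction,
    (x - y) int_0^1 f'(u x + (1 - u) y) du = f x - f y  reduces the claim to
    the expectation of (x - y)(f x - f y) / 2 under the product law, which is
    E[X f(X)] ([square_bias_zero_biased]). *)

Set Implicit Arguments.
Unset Strict Implicit.
Unset Printing Implicit Defensive.

Import Order.TTheory GRing.Theory Num.Theory.
Import numFieldNormedType.Exports.

Local Open Scope classical_set_scope.
Local Open Scope ring_scope.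

(** * The fundamental theorem for everywhere differentiable functions *)

(** A supremum argument: the set of points x with [phi a <= phi x] is closed
    under limits from the left by the first hypothesis and open to the right by
    the second one.  The first hypothesis is semicontinuity from the left, which
    every sum of a continuous and a nondecreasing function satisfies. *)
Lemma right_local_nondecreasing (R : realType) (phi : R -> R) (a b : R) :
  a <= b ->
  (forall s, a < s -> s <= b -> forall e, 0 < e -> exists2 d : R, 0 < d &
    forall y, a <= y -> s - d < y -> y < s -> phi y <= phi s + e) ->
  (forall x, a <= x -> x < b -> exists2 d : R, 0 < d &
    forall t, x < t -> t < x + d -> t <= b -> phi x <= phi t) ->
  phi a <= phi b.
Proof.
move=> ab lsc incr.
pose S := [set x | [/\ a <= x, x <= b & phi a <= phi x]].
have Sa : S a by split.
have Sb : ubound S b by move=> x [].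
have hsS : has_sup S by split; [exists a | exists b].
set s := sup S.
have as_ : a <= s by apply: ub_le_sup => //; exists b.
have sb : s <= b by apply: ge_sup => //; exists a.
have phis : phi a <= phi s.
  have [<-//|nas] := eqVneq a s.
  have alts : a < s by rewrite lt_neqAle nas.
  apply/ler_addgt0Pr => e e0.
  have [d d0 Hd] := lsc s alts sb e e0.
  have [y Sy ys] := sup_adherent d0 hsS.
  have [ay yb pay] := Sy.
  have yles : y <= s by apply: ub_le_sup => //; exists b.
  have [ysE|nys] := eqVneq y s.
    by rewrite (le_trans pay)// ysE lerDl ltW.
  by apply: (le_trans pay); apply: Hd => //; rewrite lt_neqAle nys.
have [->//|nsb] := eqVneq b s.
have sltb : s < b by rewrite lt_neqAle eq_sym nsb.
have [d d0 Hd] := incr s as_ sltb.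
pose t := Num.min b (s + d / 2).
have st : s < t by rewrite lt_min sltb ltrDl divr_gt0.
have tb : t <= b by rewrite ge_min lexx.
have : S t.
  split => //; first by rewrite (le_trans as_)// ltW.
  apply: (le_trans phis); apply: Hd => //.
  by rewrite gt_min; apply/orP; right; lra.
have hub : has_ubound S by exists b.
by move=> /(ub_le_sup hub); rewrite leNgt st.
Qed.

(** A null set lies in open sets V k whose measures are as small as desired;
    the sum of their indicators is integrable, with small integral, although
    near each point of the null set it exceeds any prescribed K.  Adding |g| on
    V 0, where its integral is small by absolute continuity, makes it dominate
    |g| there as well. *)
Lemma null_set_gauge (R : realType) (N : set R) (g : R -> R) (e : R) :
  measurable N -> (@lebesgue_measure R) N = 0%E ->
  (@lebesgue_measure R).-integrable [set: R] (EFin \o g) -> 0 < e ->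
  exists h : R -> \bar R, [/\ measurable_fun [set: R] h, (forall x, 0 <= h x)%E,
    (\int[lebesgue_measure]_x h x <= e%:E)%E &
    forall x, N x -> forall K : nat, exists2 d : R, 0 < d &
      forall y, `|x - y| < d -> ((K%:R + `|g y|)%:E <= h y)%E].
Proof.
move=> mN N0 ig e0.
have mg : measurable_fun [set: R] g.
  by apply/measurable_EFinP; exact: measurable_int ig.
have e20 : 0 < e / 2 by rewrite divr_gt0.
have [d [d0 Hd]] := integral_normr_continuous ig e20.
have Vex (k : nat) : exists U : set R, [/\ open U, N `<=` U &
    (lebesgue_measure U < (Num.min d (e / 2 / (2 ^ k.+1)%:R))%:E)%E].
  have r0 : 0 < Num.min d (e / 2 / (2 ^ k.+1)%:R).
    by rewrite lt_min d0 divr_gt0// ltr0n expn_gt0.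
  have Noo : (lebesgue_measure N < +oo)%E by rewrite N0 ltry.
  have [U [oU NU UN]] := lebesgue_regularity_outer mN Noo r0.
  exists U; split => //; apply: le_lt_trans UN.
  rewrite (measureDI lebesgue_measure (open_measurable oU) mN).
  by rewrite setIidr// [X in (_ + X)%E](_ : _ = 0%E) ?adde0.
pose V k := sval (cid (Vex k)).
have oV k : open (V k) by rewrite /V; case: cid => U [].
have NV k : N `<=` V k by rewrite /V; case: cid => U [].
have mV k : measurable (V k) by exact: open_measurable.
have Vd : (lebesgue_measure (V 0%N) < d%:E)%E.
  rewrite /V; case: cid => U [_ _ /=] /lt_le_trans; apply.
  by rewrite lee_fin ge_min lexx.
have Vk k : (lebesgue_measure (V k) <= (e / 2 / (2 ^ k.+1)%:R)%:E)%E.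
  rewrite /V; case: cid => U [_ _ /=] /ltW/le_trans; apply.
  by rewrite lee_fin ge_min lexx orbT.
pose h1 (y : R) : \bar R := (\sum_(k <oo) (\1_(V k) y : R)%:E)%E.
pose h2 (y : R) : \bar R := (`|g y| * \1_(V 0%N) y)%:E.
have m1 k : measurable_fun [set: R] (fun y => (\1_(V k) y)%:E : \bar R).
  by apply/measurable_EFinP; exact: measurable_indic.
have i0 k (y : R) : (0 <= (\1_(V k) y)%:E :> \bar R)%E by rewrite lee_fin.
have mh1 : measurable_fun [set: R] h1.
  by apply: ge0_emeasurable_sum => // k y _ _; exact: i0.
have mh2 : measurable_fun [set: R] h2.
  apply/measurable_EFinP/measurable_funM; last exact: measurable_indic.
  exact: measurableT_comp.
have h10 y : (0 <= h1 y)%E by apply: nneseries_ge0 => k _ _; exact: i0.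
have h20 y : (0 <= h2 y)%E by rewrite lee_fin mulr_ge0.
have intV k : (\int[lebesgue_measure]_x (\1_(V k) x)%:E)%E =
    lebesgue_measure (V k).
  rewrite integral_indic; [by rewrite setIT|exact: measurableT|exact: mV].
exists (fun y => h1 y + h2 y)%E; split.
- exact: emeasurable_funD.
- by move=> y; rewrite adde_ge0.
- rewrite ge0_integralD//= integral_nneseries//.
  rewrite [e in leRHS](splitr e) EFinD; apply: leeD.
    rewrite (eq_eseriesr (fun k _ => intV k)).
    have := @epsilon_trick R (fun=> 0%E) (e / 2) xpredT (fun=> lexx _) (ltW e20).
    rewrite [X in (_ <= X + _)%E]eseries0// add0e; apply: le_trans.
    by apply: lee_nneseries => // k _; rewrite add0e; exact: Vk.
  have := Hd _ (mV 0%N) Vd; rewrite /Rintegral => /ltW; rewrite -lee_fin.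
  rewrite fineK.
    apply: le_trans; rewrite [leRHS]integral_mkcond.
    under [leRHS]eq_integral => x _.
      rewrite patchE (_ : (if _ then _ else _) = h2 x); last first.
        by rewrite /h2 indicE; case: ifPn => _; rewrite ?mulr1// mulr0.
      over.
    exact: lexx.
  apply: integrable_fin_num; first exact: mV.
  apply: (integrableS measurableT) => //; first exact: mV.
  exact: (integrable_norm ig).
- move=> x Nx K.
  have [d' d'0 Hd'] : exists2 d' : R, 0 < d' & forall y, `|x - y| < d' ->
      forall k, (k <= K)%N -> V k y.
    elim: K => [|K [d1 d10 IH]].
      have := oV 0%N; rewrite openE => /(_ _ (NV _ _ Nx)) [r /= r0 Hr].
      exists r => // y xy k; rewrite leqn0 => /eqP ->; exact: Hr.
    have := oV K.+1; rewrite openE => /(_ _ (NV _ _ Nx)) [r /= r0 Hr].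
    exists (Num.min d1 r); first by rewrite lt_min d10.
    move=> y; rewrite lt_min => /andP[y1 y2] k.
    rewrite leq_eqVlt => /predU1P[->|]; first exact: Hr.
    exact: IH.
  exists d' => // y xy; rewrite EFinD; apply: leeD.
    apply: (@le_trans _ _ (\sum_(0 <= k < K) (\1_(V k) y)%:E)%E).
      rewrite big_nat (eq_bigr (fun=> 1%E)) -?big_nat; last first.
        move=> k /andP[_ kK]; rewrite indicE mem_set//.
        by apply: Hd' => //; exact: ltnW.
      by rewrite sumEFin sumr_const_nat subn0.
    exact: nneseries_lim_ge.
  by rewrite /h2 indicE mem_set ?mulr1//; exact: Hd'.
Qed.

Lemma derivable_epsilon (R : realType) (f : R -> R) (x e : R) :
  derivable f x 1 -> 0 < e -> exists2 d : R, 0 < d &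
  forall t, `|t - x| < d -> `|f t - f x - derive1 f x * (t - x)| <= e * `|t - x|.
Proof.
move=> df e0.
have : (fun h => h^-1 *: (f (h + x) - f x)) @ 0^' --> derive1 f x.
  have := df; rewrite /derivable /derive1.
  suff -> : (fun h : R => h^-1 *: ((f \o shift x) (h *: 1) - f x)) =
            (fun h => h^-1 *: (f (h + x) - f x)) by [].
  by apply/funext => h /=; rewrite [h%:A]mulr1.
move/cvgrPdist_le => /(_ e e0).
rewrite near_withinE => /nbhs_ballP[d /= d0 Hd].
exists d => // t td.
have [->|ntx] := eqVneq t x; first by rewrite !subrr mulr0 subr0 normr0 mulr0.
have tx0 : t - x != 0 by rewrite subr_eq0.
have := Hd (t - x); rewrite /ball/= sub0r normrN => /(_ td tx0).
rewrite subrK => H.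
have -> : f t - f x - derive1 f x * (t - x) =
    - ((derive1 f x - (t - x)^-1 *: (f t - f x)) * (t - x)).
  by rewrite /GRing.scale/=; field.
by rewrite normrN normrM ler_pM2r ?normr_gt0.
Qed.

Lemma integral_itv_bndc_split (R : realType) (h : R -> \bar R) (a x t : R) :
  measurable_fun [set: R] h -> (forall x, 0 <= h x)%E -> a <= x -> x <= t ->
  (\int[lebesgue_measure]_(y in `[a, t]) h y =
   \int[lebesgue_measure]_(y in `[a, x]) h y +
   \int[lebesgue_measure]_(y in `]x, t]) h y)%E.
Proof.
move=> mh h0 ax xt.
rewrite (@itv_bndbnd_setU _ _ _ (BRight x)) ?bnd_simp//.
rewrite ge0_integral_setU//=.
  exact: measurable_funTS.
apply/disj_setPS => y [/=]; rewrite !in_itv/= => /andP[_ yx] /andP[].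
by rewrite ltNge yx.
Qed.

(** The difference Phi between f and the indefinite integral G of f' has
    derivative 0 outside a null set N, by Lebesgue's differentiation theorem.
    At a point of N the increments of Phi are at most K (t - x) plus the
    integral of |f'|, with K depending on the point, and those are dominated by
    the increments of the indefinite integral H of a gauge function for N.
    Hence both Phi + e (x - a) + H and - Phi + e (x - a) + H increase
    locally to the right at every point; as H has total variation at most e,
    which is arbitrary, Phi a = Phi b. *)
Lemma integrable_derive1_FTC2 (R : realType) (f : R -> R) (a b : R) : a <= b ->
  (forall x, derivable f x 1) ->
  (@lebesgue_measure R).-integrable `[a, b] (EFin \o derive1 f) ->
  (\int[lebesgue_measure]_(x in `[a, b]) derive1 f x)%R = f b - f a.
Proof.
rewrite le_eqVlt => /predU1P[<- _ _|ab df idf].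
  by rewrite set_itv1 Rintegral_set1 subrr.
pose mu := @lebesgue_measure R.
pose g := derive1 f \_ `[a, b].
have ig : mu.-integrable [set: R] (EFin \o g).
  by rewrite /g -restrict_EFin; apply/integrable_restrict => //=; rewrite setTI.
have igS (A : set R) : measurable A -> mu.-integrable A (EFin \o g).
  by move=> mA; apply: integrableS ig.
have -> : (\int[lebesgue_measure]_(x in `[a, b]) derive1 f x)%R =
    (\int[lebesgue_measure]_(x in `[a, b]) g x)%R.
  by apply: eq_Rintegral => x; rewrite inE/= => xab; rewrite /g patchE mem_set.
pose G x := (\int[lebesgue_measure]_(t in `[a, x]) g t)%R.
rewrite -/(G b).
pose Phi x := f x - G x.
have Ginc x t : a <= x -> x <= t ->
    `|G t - G x| <= (\int[lebesgue_measure]_(y in `]x, t]) `|g y|)%R.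
  move=> ax xt; rewrite /G Rintegral_itvB ?bnd_simp//; last exact: igS.
  by apply: le_normr_Rintegral => //; exact: igS.
have Phiinc x t : a <= x -> x <= t -> `|Phi t - Phi x| <=
    `|f t - f x| + (\int[lebesgue_measure]_(y in `]x, t]) `|g y|)%R.
  move=> ax xt; rewrite /Phi.
  rewrite (_ : _ - _ = (f t - f x) - (G t - G x)); last by ring.
  by rewrite (le_trans (ler_normB _ _))// lerD2l Ginc.
have [N0 [mN0 N00 HN0]] : mu.-negligible (~` [set x | a < x ->
    derivable G x 1 /\ derive1 G x = g x]).
  have := @FTC1 R g (BLeft a) (fun y => igS _ (measurable_itv _)).
  have lg : locally_integrable [set: R] g.
    by apply: open_integrable_locally => //; exact: openT.
  move=> /(_ lg); rewrite /almost_everywhere/=; apply: negligibleS => x/=.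
  apply: contra_not => H ax; apply: H; rewrite lte_fin; exact: ax.
(* The point a is added because the differentiation theorem is silent there. *)
pose N := N0 `|` [set a].
have mN : measurable N by apply: measurableU.
have N0E : mu N = 0%E.
  rewrite -N00; apply: measureU0 => //; exact: lebesgue_measure_set1.
(* The two signs of Phi are treated at once through a factor c with |c| = 1. *)
suff key (e c : R) : 0 < e -> `|c| = 1 -> c * Phi a <= c * Phi b + e * (b - a) + e.
  have eqP : Phi a = Phi b.
    apply/eqP; rewrite eq_le; apply/andP; split; apply/ler_addgt0Pr => e e0.
    - have e'0 : 0 < e / (b - a + 1) by rewrite divr_gt0//; lra.
      have := key _ 1 e'0 (normr1 _); rewrite !mul1r => /le_trans; apply.
      rewrite -addrA lerD2l -[X in _ + X]mulr1 -mulrDr divfK//; lra.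
    - have e'0 : 0 < e / (b - a + 1) by rewrite divr_gt0//; lra.
      have := key _ (-1) e'0 (normrN1 _).
      have -> : -1 * Phi b + e / (b - a + 1) * (b - a) + e / (b - a + 1) =
        - Phi b + e by field; lra.
      lra.
  move: eqP; rewrite /Phi (_ : G a = 0); last first.
    by rewrite /G set_itv1 Rintegral_set1.
  lra.
move=> e0 c1.
have [h [mh h0 he Hh]] := null_set_gauge mN N0E ig e0.
have hle (A : set R) : measurable A -> (\int[mu]_(y in A) h y <= e%:E)%E.
  move=> mA; apply: le_trans he; apply: ge0_subset_integral => //.
have hfin (A : set R) : measurable A -> (\int[mu]_(y in A) h y)%E \is a fin_num.
  move=> mA; rewrite ge0_fin_numE; last by apply: integral_ge0.
  by rewrite (le_lt_trans (hle _ mA))// ltry.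
pose H x := fine (\int[mu]_(y in `[a, x]) h y)%E.
have Hinc x t : a <= x -> x <= t ->
    H t = H x + fine (\int[mu]_(y in `]x, t]) h y)%E.
  move=> ax xt; rewrite /H (integral_itv_bndc_split mh h0 ax xt) fineD//;
    exact: hfin.
have Hnd x t : a <= x -> x <= t -> H x <= H t.
  move=> ax xt; rewrite (Hinc x t)// lerDl fine_ge0//.
  by apply: integral_ge0.
have Hb : H b <= e.
  by rewrite -lee_fin /H fineK; [exact: hle|exact: hfin].
have Ha : H a = 0 by rewrite /H set_itv1 integral_set1.
pose phi x := c * Phi x + e * (x - a) + H x.
suff : phi a <= phi b by rewrite /phi Ha; lra.
have cPhi x t : `|c * Phi x - c * Phi t| = `|Phi t - Phi x|.
  by rewrite -mulrBr normrM c1 mul1r distrC.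
apply: right_local_nondecreasing; first exact: ltW.
- move=> s as_ sb e' e'0.
  have e'2 : 0 < e' / 2 by rewrite divr_gt0.
  have [d1 [d10 Hd1]] := integral_normr_continuous ig e'2.
  have cf : {for s, continuous f}.
    exact/differentiable_continuous/derivable1_diffP.
  move/cvgrPdist_le : cf => /(_ _ e'2) /nbhs_ballP[d2 /= d20 Hd2].
  exists (Num.min d1 d2); first by rewrite lt_min d10.
  move=> y ay yd ys.
  have ysd1 : s - y < d1.
    by rewrite ltrBlDr -ltrBlDl (le_lt_trans _ yd)// lerB// ge_min lexx.
  have ysd2 : s - y < d2.
    by rewrite ltrBlDr -ltrBlDl (le_lt_trans _ yd)// lerB// ge_min lexx orbT.
  have Pd : `|Phi s - Phi y| <= e'.
    rewrite (le_trans (Phiinc y s ay (ltW ys)))// (splitr e') lerD//.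
      apply: Hd2; rewrite /ball/= gtr0_norm ?subr_gt0//.
    apply: ltW; apply: Hd1 => //.
    by rewrite [ltLHS](lebesgue_measure_itv `]y, s])/= lte_fin ys -EFinD lte_fin.
  have := Hnd y s ay (ltW ys).
  have : e * (y - a) <= e * (s - a) by rewrite ler_pM2l// lerB// ltW.
  have := le_trans (ler_norm _) (eq_ind_r (fun z => z <= e') Pd (cPhi y s)).
  rewrite /phi; lra.
- move=> x ax xb.
  have [Nx|nNx] := pselect (N x).
  (* K bounds the difference quotients of f near x. *)
  + pose K := (Num.truncn (`|derive1 f x| + 1)).+1.
    have [d1 d10 Hd1] := derivable_epsilon (df x) ltr01.
    have [d2 d20 Hd2] := Hh _ Nx K.
    exists (Num.min d1 d2); first by rewrite lt_min d10.
    move=> t xt td tb.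
    have td1 : t - x < d1.
      by rewrite ltrBlDl (lt_le_trans td)// lerD2l ge_min lexx.
    have td2 : t - x < d2.
      by rewrite ltrBlDl (lt_le_trans td)// lerD2l ge_min lexx orbT.
    have ft : `|f t - f x| <= K%:R * (t - x).
      have := Hd1 t; rewrite gtr0_norm ?subr_gt0// => /(_ td1) ftx.
      have -> : f t - f x = (f t - f x - derive1 f x * (t - x)) + derive1 f x * (t - x).
        by ring.
      rewrite (le_trans (ler_normD _ _))//.
      apply: (@le_trans _ _ (1 * (t - x) + `|derive1 f x| * (t - x))).
        by rewrite lerD// normrM (gtr0_norm (_ : 0 < t - x))// subr_gt0.
      rewrite -mulrDl ler_pM2r ?subr_gt0// addrC ltW//.
      exact: truncnS_gt.
    have ht : K%:R * (t - x) + (\int[lebesgue_measure]_(y in `]x, t]) `|g y|)%R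
        <= fine (\int[mu]_(y in `]x, t]) h y)%E.
      rewrite -lee_fin fineK; last exact: hfin.
      have -> : (K%:R * (t - x) + \int[lebesgue_measure]_(y in `]x, t]) `|g y|)%:E
          = (\int[mu]_(y in `]x, t]) (K%:R%:E + `|g y|%:E))%E.
        rewrite ge0_integralD//=.
        * rewrite integral_cst//= EFinD; congr (_ + _)%E.
            rewrite lebesgue_measure_itv/= lte_fin xt -EFinD -EFinM//.
          rewrite /Rintegral fineK//; apply: integrable_fin_num => //.
          exact: (integrable_norm (igS _ (measurable_itv _))).
        * apply/measurable_EFinP; apply: measurableT_comp => //.
          apply/measurable_EFinP; apply: measurable_int (igS _ _) => //.
      apply: ge0_le_integral => //=.
      * by move=> y _; rewrite adde_ge0.
      * suff : measurable_fun `]x, t] (EFin \o (fun y => K%:R + `|g y|)) by [].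
        apply/measurable_EFinP; apply: measurable_funD => //.
        apply: measurableT_comp => //; apply/measurable_EFinP; apply: measurable_int (igS _ _) => //.
      * exact: measurable_funTS.
      * move=> y; rewrite in_itv/= => /andP[xy yt].
        rewrite -EFinD; apply: Hd2.
        rewrite ltr0_norm ?subr_lt0// opprB (le_lt_trans _ td2)// lerB//.
    have : `|Phi t - Phi x| <= H t - H x.
      rewrite (Hinc x t ax (ltW xt)) [leRHS]addrC addKr.
      apply: le_trans (Phiinc x t ax (ltW xt)) _.
      by apply: le_trans ht; rewrite lerD2r.
    have : e * (x - a) <= e * (t - a) by rewrite ler_pM2l// lerB// ltW.
    have := ler_norm (c * Phi x - c * Phi t); rewrite cPhi.
    rewrite /phi; lra.
  + have axs : a < x.
      by rewrite lt_neqAle ax andbT; apply/eqP => xa; apply: nNx; right.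
    have [dG G'x] : derivable G x 1 /\ derive1 G x = g x.
      have : ~ N0 x by move=> ?; apply: nNx; left.
      by move/(contra_not (@HN0 x)); rewrite /= notK; apply.
    have gx : g x = derive1 f x.
      by rewrite /g patchE mem_set//= in_itv/= (ltW xb) ax.
    have e2 : 0 < e / 2 by rewrite divr_gt0.
    have [d1 d10 Hd1] := derivable_epsilon (df x) e2.
    have [d2 d20 Hd2] := derivable_epsilon dG e2.
    exists (Num.min d1 d2); first by rewrite lt_min d10.
    move=> t xt td tb.
    have td1 : t - x < d1.
      by rewrite ltrBlDl (lt_le_trans td)// lerD2l ge_min lexx.
    have td2 : t - x < d2.
      by rewrite ltrBlDl (lt_le_trans td)// lerD2l ge_min lexx orbT.
    have Pt : `|Phi t - Phi x| <= e * (t - x).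
      have := Hd1 t; have := Hd2 t; rewrite gtr0_norm ?subr_gt0//.
      move=> /(_ td2) H2 /(_ td1) H1.
      have -> : Phi t - Phi x = (f t - f x - derive1 f x * (t - x))
          - (G t - G x - derive1 G x * (t - x)).
        by rewrite /Phi G'x gx; ring.
      rewrite (le_trans (ler_normB _ _))//.
      by rewrite (splitr e) mulrDl lerD.
    have := Hnd x t ax (ltW xt).
    have := ler_norm (c * Phi x - c * Phi t); rewrite cPhi.
    move: Pt; rewrite /phi !mulrBr; lra.
Qed.

(** * Expectations under a law with a density *)

Section ge0_integral_density.
Import HBNNSimple.

(** By definition for indicators, by linearity for simple functions, and by
    monotone convergence on both sides in general. *)
Lemma ge0_integral_density d (T : measurableType d) (R : realType)
    (mu nu : {measure set T -> \bar R}) (p : T -> R) (f : T -> \bar R) :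
  measurable_fun [set: T] p -> (forall x, 0 <= p x) ->
  (forall A, measurable A -> nu A = \int[mu]_(x in A) (p x)%:E)%E ->
  measurable_fun [set: T] f -> (forall x, 0 <= f x)%E ->
  (\int[nu]_x f x = \int[mu]_x (f x * (p x)%:E))%E.
Proof.
move=> mp p0 nuE mf f0; pose h := nnsfun_approx measurableT mf.
have mpE : measurable_fun [set: T] (EFin \o p) by apply/measurable_EFinP.
have -> : (\int[nu]_x f x = lim (\int[nu]_x (EFin \o h n) x @[n --> \oo]))%E.
  have fE x : f x = lim ((EFin \o h n) x @[n --> \oo]).
    by apply/esym/cvg_lim => //; exact: cvg_nnsfun_approx.
  under eq_integral do rewrite fE.
  apply: monotone_convergence => //.
  - by move=> n; apply/measurable_EFinP.
  - by move=> n x _ /=; rewrite lee_fin.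
  - by move=> x _ a b ab; rewrite lee_fin; exact/lefP/nd_nnsfun_approx.
have -> : (\int[mu]_x (f x * (p x)%:E) =
    lim (\int[mu]_x (((EFin \o h n) \* (EFin \o p)) x) @[n --> \oo]))%E.
  have fE x : (f x * (p x)%:E = lim (((EFin \o h n) \* (EFin \o p)) x @[n --> \oo]))%E.
    apply/esym/cvg_lim => //; apply: cvgeZr => //.
    exact: cvg_nnsfun_approx.
  under eq_integral do rewrite fE.
  apply: monotone_convergence => //.
  - by move=> n; apply: emeasurable_funM => //; apply/measurable_EFinP.
  - by move=> n x _ /=; rewrite -EFinM lee_fin mulr_ge0.
  - move=> x _ a b ab /=; rewrite lee_wpmul2r ?lee_fin//.
    exact/lefP/nd_nnsfun_approx.
apply: congr_lim; apply/funext => n /=.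
transitivity (\int[nu]_x
   (\sum_(y \in range (h n)) (y * \1_(h n @^-1` [set y]) x)%:E))%E.
  by apply: eq_integral => t tE; rewrite /= fimfunE -fsumEFin.
have indich r : measurable_fun [set: T] (fun x => (r * \1_(h n @^-1` [set r]) x)%:E).
  by apply/measurable_EFinP; exact: measurable_funM.
rewrite ge0_integral_fsum//; last by move=> y x _; exact: nnfun_muleindic_ge0.
transitivity (\int[mu]_x (\sum_(y \in range (h n))
    (y * \1_(h n @^-1` [set y]) x)%:E * (p x)%:E))%E; last first.
  apply: eq_integral => x xE.
  rewrite -ge0_mule_fsuml => [|y]; last exact: nnfun_muleindic_ge0.
  by rewrite fsumEFin // -(fimfunE _ x).
rewrite ge0_integral_fsum//.
- apply: eq_fsbigr => r rhn.
  under eq_integral do rewrite EFinM.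
  rewrite integralZl_indic_nnsfun// integral_indic// setIT.
  under [RHS]eq_integral do rewrite EFinM -muleA.
  rewrite ge0_integralZl//.
  + congr (_ * _)%E; rewrite nuE//.
    rewrite integral_mkcond; apply: eq_integral => x _.
    by rewrite patchE indicE; case: ifPn; rewrite ?mul1e ?mul0e.
  + apply: emeasurable_funM => //.
    by apply/measurable_EFinP; exact: measurable_indic.
  + by move=> x _; rewrite mule_ge0// lee_fin.
  + by move: rhn; rewrite inE => -[x _ <-]; rewrite lee_fin.
- move=> r; apply: emeasurable_funM => //.
- by move=> r x _; rewrite mule_ge0//; [exact: nnfun_muleindic_ge0|rewrite lee_fin].
Qed.

End ge0_integral_density.

Section density_measure.
Context d (T : measurableType d) (R : realType) (mu : {measure set T -> \bar R}).
Variable p : T -> R.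
Hypotheses (mp : measurable_fun [set: T] p) (p0 : forall x, 0 <= p x).

(** The measurability and positivity of p are arguments so that the measure
    structure below can be attached to the function. *)
Definition density_measure of measurable_fun [set: T] p & (forall x, 0 <= p x) :=
  fun A : set T => (\int[mu]_(x in A) (p x)%:E)%E.

Local Notation nu := (density_measure mp p0).

Let nu0 : nu set0 = 0%E.
Proof. exact: integral_set0. Qed.

Let nu_ge0 A : (0 <= nu A)%E.
Proof. by apply: integral_ge0 => x _; rewrite lee_fin. Qed.

Let nu_sigma_additive : semi_sigma_additive nu.
Proof.
move=> F mF tF mUF; rewrite /density_measure ge0_integral_bigcup//.
- apply: is_cvg_ereal_nneg_natsum_cond => n _ _.
  by apply: integral_ge0 => x _; rewrite lee_fin.
- by apply/measurable_EFinP; exact: measurable_funTS.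
- by move=> x _; rewrite lee_fin.
Qed.

HB.instance Definition _ :=
  isMeasure.Build _ _ _ nu nu0 nu_ge0 nu_sigma_additive.

End density_measure.

Lemma integral_density d (T : measurableType d) (R : realType)
    (mu nu : {measure set T -> \bar R}) (p : T -> R) (f : T -> R) :
  measurable_fun [set: T] p -> (forall x, 0 <= p x) ->
  (forall A, measurable A -> nu A = \int[mu]_(x in A) (p x)%:E)%E ->
  nu.-integrable [set: T] (EFin \o f) ->
  mu.-integrable [set: T] (fun x => (f x * p x)%:E) /\
  (\int[nu]_x (f x)%:E = \int[mu]_x (f x * p x)%:E)%E.
Proof.
move=> mp p0 nuE ifn; have mf : measurable_fun [set: T] f.
  by apply/measurable_EFinP; exact: measurable_int ifn.
have mfE : measurable_fun [set: T] (EFin \o f) by apply/measurable_EFinP.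
split.
  apply/integrableP; split.
    by apply/measurable_EFinP; exact: measurable_funM.
  have /integrableP[_] := ifn.
  rewrite (ge0_integral_density mp p0 nuE)//; last exact: measurableT_comp.
  under eq_integral do rewrite /= -EFinM -[X in (_ * X)%:E]ger0_norm// -normrM.
  by [].
rewrite [LHS]integralE [RHS]integralE.
rewrite (ge0_integral_density mp p0 nuE)//; last exact: measurable_funepos.
rewrite (ge0_integral_density mp p0 nuE)//; last exact: measurable_funeneg.
congr (_ - _)%E; apply: eq_integral => x _.
- by rewrite !funeposE/= -!EFin_max -EFinM maxr_pMl// mul0r.
- by rewrite !funenegE/= -!EFin_max -EFinM maxr_pMl// mul0r mulNr.
Qed.

Section has_density_expectation.
Context d (T : measurableType d) (R : realType) (Q : probability T R).
Variables (Y : {RV Q >-> R}) (p : R -> R).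

Let mY : @measurable_fun _ _ T (measurableTypeR R) [set: T] Y.
Proof. exact: (measurable_funPT Y). Qed.

(** Lebesgue measure is carried by the Borel sets generated by half-open
    intervals; seen with this codomain, the law of Y is a measure on the same
    measurable space and can be compared with it. *)
Definition borel_rv : {mfun T >-> measurableTypeR R} :=
  @mfun_Sub _ _ T (measurableTypeR R) Y (mem_set mY).

Hypothesis Yp : has_density (distribution Q Y) p.

Let mp : measurable_fun [set: measurableTypeR R] p.
Proof. by case: Yp. Qed.

Let p0 x : 0 <= p x. Proof. by case: Yp. Qed.

Let pE (A : set (measurableTypeR R)) : measurable A ->
  distribution Q borel_rv A = (\int[lebesgue_measure]_(x in A) (p x)%:E)%E.
Proof. by case: Yp => _ _; exact. Qed.

Lemma ge0_has_density_expectation (g : R -> \bar R) :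
  measurable_fun [set: R] g -> (forall x, 0 <= g x)%E ->
  (\int[Q]_w g (Y w) = \int[lebesgue_measure]_x (g x * (p x)%:E))%E.
Proof.
move=> mg g0; rewrite -(ge0_integral_density mp p0 pE mg g0).
by rewrite ge0_integral_distribution.
Qed.

Lemma has_density_expectation (g : R -> R) : measurable_fun [set: R] g ->
  Q.-integrable [set: T] (fun w => (g (Y w))%:E) ->
  (@lebesgue_measure R).-integrable [set: R] (fun x => (g x * p x)%:E) /\
  (\int[Q]_w (g (Y w))%:E = \int[lebesgue_measure]_x (g x * p x)%:E)%E.
Proof.
move=> mg ig.
have mgE : measurable_fun [set: measurableTypeR R] (EFin \o g).
  exact/measurable_EFinP.
have igd : (distribution Q borel_rv).-integrable [set: measurableTypeR R] (EFin \o g).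
  apply/integrableP; split => //.
  rewrite ge0_integral_distribution//; last exact: measurableT_comp.
  by have /integrableP[] := ig.
have [igp gp] := integral_density mp p0 pE igd.
split => //; rewrite -gp.
exact/esym/(integral_distribution (X := borel_rv) mgE ig).
Qed.

End has_density_expectation.

Lemma same_law_expectation d d' (T : measurableType d) (T' : measurableType d')
    (R : realType) (P : probability T R) (Q : probability T' R)
    (Y : {RV P >-> R}) (Z : {RV Q >-> R}) (g : R -> R) :
  same_law (distribution P Y) (distribution Q Z) -> measurable_fun [set: R] g ->
  P.-integrable [set: T] (fun w => (g (Y w))%:E) ->
  Q.-integrable [set: T'] (fun w => (g (Z w))%:E) /\
  (\int[Q]_w (g (Z w))%:E = \int[P]_w (g (Y w))%:E)%E.
Proof.
move=> YZ mg ig.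
have mgE : measurable_fun [set: measurableTypeR R] (EFin \o g).
  exact/measurable_EFinP.
have mag : measurable_fun [set: measurableTypeR R] (fun x => `|(g x)%:E|%E).
  exact: measurableT_comp mgE.
have iZ : Q.-integrable [set: T'] (fun w => (g (Z w))%:E).
  apply/integrableP; split.
    by apply/measurable_EFinP; exact: measurableT_comp.
  rewrite -(ge0_integral_distribution (borel_rv Z) mag)//.
  rewrite (eq_measure_integral (distribution P (borel_rv Y))).
    rewrite ge0_integral_distribution//.
    by have /integrableP[] := ig.
  by move=> A mA _; exact/esym/YZ.
split => //.
rewrite -(integral_distribution (X := borel_rv Z) mgE iZ).
rewrite -(integral_distribution (X := borel_rv Y) mgE ig).
by apply: eq_measure_integral => A mA _; exact/esym/YZ.
Qed.

(** * The zero bias kernel and density *)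

(** Equal to |x| when t lies between 0 and x, and to 0 otherwise. *)
Definition zero_bias_kernel (R : realType) (x t : R) : R :=
  x * ((t < x)%R%:R - (t < 0)%R%:R).

Lemma zero_bias_kernel_ge0 (R : realType) (x t : R) : 0 <= zero_bias_kernel x t.
Proof.
rewrite /zero_bias_kernel; case: ltP => h1; case: ltP => h2 /=; nra.
Qed.

Lemma measurable_zero_bias_kernel (R : realType) :
  measurable_fun [set: R * R] (fun z => zero_bias_kernel z.1 z.2).
Proof.
have mI (b : R * R -> bool) : measurable_fun [set: R * R] b ->
    measurable_fun [set: R * R] (fun z => (b z)%:R : R).
  move=> mb; rewrite (_ : (fun _ => _) = (fun z => if b z then 1 else 0)).
    exact: measurable_fun_ifT.
  by apply/funext => z; case: (b z).
apply: measurable_funM => //; apply: measurable_funB; apply: mI.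
- exact: measurable_fun_ltr.
- exact: measurable_fun_ltr.
Qed.

(** The derivative is the pointwise limit of the difference quotients with
    steps 1 / (n + 1). *)
Lemma measurable_derive1 (R : realType) (f : R -> R) :
  (forall x, derivable f x 1) -> measurable_fun [set: R] (derive1 f).
Proof.
move=> df.
have cf : continuous f.
  by move=> x; exact/differentiable_continuous/derivable1_diffP.
have mf : measurable_fun [set: R] f by exact: continuous_measurable_fun.
pose q n x := (f (x + n.+1%:R^-1) - f x) * n.+1%:R.
apply/measurable_EFinP.
apply: (emeasurable_fun_cvg (fun n => EFin \o q n)).
- move=> n; apply/measurable_EFinP; apply: measurable_funM => //.
  apply: measurable_funB => //.
  apply: measurableT_comp => //; exact: measurable_funD.
- move=> x _; apply: cvg_EFin; first exact: nearW.
  apply/cvgrPdist_le => e e0.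
  have [d d0 Hd] := derivable_epsilon (df x) e0.
  near=> n.
  have n0 : 0 < n.+1%:R^-1 :> R by rewrite invr_gt0.
  have := Hd (x + n.+1%:R^-1).
  rewrite addrAC subrr add0r gtr0_norm// => /(_ _) H.
  have {H} : `|f (x + n.+1%:R^-1) - f x - derive1 f x * n.+1%:R^-1| <=
    e * n.+1%:R^-1.
    apply: H; near: n; exact: near_infty_natSinv_lt (PosNum d0).
  rewrite ler_pdivlMr// -[X in _ * X]gtr0_norm// -normrM.
  rewrite mulrBl divfK//= /q distrC//.
Unshelve. all: by end_near. Qed.

(** The kernel k(x, .) is |x| times the indicator of the interval between 0
    and x, so its integral against f' is x times an increment of f. *)
Lemma zero_bias_kernel_FTC (R : realType) (f : R -> R) (x : R) :
  (forall x, derivable f x 1) ->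
  (@lebesgue_measure R).-integrable [set: R]
    (fun t => (zero_bias_kernel x t * derive1 f t)%:E) ->
  (\int[lebesgue_measure]_t (zero_bias_kernel x t * derive1 f t)%:E =
   (x * (f x - f 0))%:E)%E.
Proof.
move=> df.
have mf' := measurable_derive1 df.
have key (a b c : R) : a < b -> c != 0 ->
    (forall t, zero_bias_kernel x t = c * \1_`[a, b[ t) ->
    c * (f b - f a) = x * (f x - f 0) ->
  (@lebesgue_measure R).-integrable [set: R]
    (fun t => (zero_bias_kernel x t * derive1 f t)%:E) ->
  (\int[lebesgue_measure]_t (zero_bias_kernel x t * derive1 f t)%:E =
   (x * (f x - f 0))%:E)%E.
  move=> ab c0 kE <-.
  have -> : (fun t => (zero_bias_kernel x t * derive1 f t)%:E) =
      (EFin \o (fun t => c * derive1 f t)) \_ `[a, b[.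
    apply/funext => t; rewrite patchE kE indicE.
    by case: ifPn => _; rewrite ?mulr1// mulr0 mul0r.
  move=> ic0; have ic : (@lebesgue_measure R).-integrable `[a, b[
      (EFin \o (fun t => c * derive1 f t)).
    by apply/integrable_mkcond.
  rewrite -integral_mkcond.
  have idf : (@lebesgue_measure R).-integrable `[a, b[ (EFin \o derive1 f).
    have -> : EFin \o derive1 f =
        (fun t => (c^-1)%:E * (EFin \o (fun t => c * derive1 f t)%R) t)%E.
      by apply/funext => t /=; rewrite -EFinM mulKf.
    exact: integrableZl.
  have idfc : (@lebesgue_measure R).-integrable `[a, b] (EFin \o derive1 f).
    apply/integrableP; split.
      by apply/measurable_EFinP; exact: measurable_funTS.
    rewrite -integral_itv_bndo_bndc//; first by case/integrableP : idf.
    apply: measurableT_comp => //.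
    by apply/measurable_EFinP; exact: measurable_funTS.
  rewrite (integralZl _ idf)//.
  have := integrable_derive1_FTC2 (ltW ab) df idfc.
  rewrite /Rintegral => <-; rewrite integral_itv_bndo_bndc//; last first.
    by apply/measurable_EFinP; exact: measurable_funTS.
  by rewrite EFinM fineK//; exact: integrable_fin_num idfc.
have [x0|x0|->] := ltgtP x 0.
- apply: (key x 0 (- x)) => //; rewrite ?oppr_eq0 ?lt_eqF//; last by ring.
  move=> t; rewrite /zero_bias_kernel indicE.
  rewrite (_ : (t \in _) = (x <= t < 0)); last by rewrite mem_setE in_itv.
  by case: (ltP t x) => h1; case: (ltP t 0) => h2 /=; lra.
- apply: (key 0 x x) => //; rewrite ?gt_eqF//.
  move=> t; rewrite /zero_bias_kernel indicE.
  rewrite (_ : (t \in _) = (0 <= t < x)); last by rewrite mem_setE in_itv.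
  by case: (ltP t x) => h1; case: (ltP t 0) => h2 /=; lra.
- move=> _; rewrite mul0r integral0_eq// => t _.
  by rewrite /zero_bias_kernel !mul0r.
Qed.

Section zero_bias_density_theory.
Context d (T : measurableType d) (R : realType) (P : probability T R).
Variables (W : {RV P >-> R}) (v : R).
Hypothesis W2 : (W : T -> R) \in Lfun P 2%:E.
Hypothesis EW : ('E_P[W] = 0)%E.
Hypothesis v0 : 0 < v.
Hypothesis VW : ('V_P[W] = v%:E)%E.

Let p := zero_bias_density P W.

Lemma L2_integrable : P.-integrable [set: T] (EFin \o W).
Proof.
by apply/Lfun1_integrable; rewrite Lfun_subset12// fin_num_measure.
Qed.

(** The term x [t < 0] of the kernel has expectation 0 since W is centred,
    and the other term is W 1(W > t). *)
Lemma zero_bias_kernel_mean t :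
  (\int[P]_w (zero_bias_kernel (W w) t)%:E = (v * p t)%:E)%E.
Proof.
have iW := L2_integrable.
have mI : measurable [set w | t < W w].
  rewrite (_ : [set w | _] = W @^-1` `]t, +oo[); last first.
    by apply/seteqP; split => w /=; rewrite in_itv/= andbT.
  exact: measurable_funPTI.
pose Y w := W w * \1_[set y | t < W y] w.
have iY : P.-integrable [set: T] (EFin \o Y).
  apply: le_integrable iW => //.
  - by apply/measurable_EFinP; apply: measurable_funM.
  - move=> w _ /=; rewrite lee_fin normrM indicE.
    by rewrite ler_piMr// normr_nat; case: (_ \in _).
have -> : (fun w => (zero_bias_kernel (W w) t)%:E) =
    (fun w => (EFin \o Y) w - ((t < 0)%R%:R)%:E * (EFin \o W) w)%E.
  apply/funext => w; rewrite /zero_bias_kernel mulrBr EFinB; congr (_ - _)%E.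
    rewrite /Y/= indicE; congr (_ * (nat_of_bool _)%:R)%:E.
    by apply/idP/idP => [?|/set_mem//]; exact/mem_set.
  by rewrite mulrC EFinM.
rewrite integralB//; last exact: integrableZl.
rewrite integralZl// (_ : \int[P]_w (EFin \o W) w = 0)%E; last first.
  by move: EW; rewrite unlock.
rewrite mule0 sube0 /p /zero_bias_density VW/= mulrA mulfV ?gt_eqF// mul1r.
rewrite unlock fineK//; exact: integrable_fin_num iY.
Qed.

Lemma zero_bias_density_ge0 t : 0 <= p t.
Proof.
rewrite -(pmulr_rge0 _ v0) -lee_fin -zero_bias_kernel_mean.
by apply: integral_ge0 => w _; rewrite lee_fin zero_bias_kernel_ge0.
Qed.

Let kW (z : T * R) : \bar R := (zero_bias_kernel (W z.1) z.2)%:E.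

Let measurable_kW : measurable_fun [set: T * R] kW.
Proof.
apply/measurable_EFinP.
have mg : measurable_fun [set: T * R] (fun z => (W z.1, z.2)).
  apply: measurable_fun_pair => //; exact: measurableT_comp.
exact: (measurableT_comp (@measurable_zero_bias_kernel R) mg).
Qed.

Lemma measurable_zero_bias_density : measurable_fun [set: R] p.
Proof.
have : measurable_fun [set: R] (fun t => (v * p t)%:E).
  under eq_fun do rewrite -zero_bias_kernel_mean.
  apply: (measurable_fun_fubini_tonelli_G kW) => //.
  by move=> z; rewrite lee_fin zero_bias_kernel_ge0.
move/measurable_EFinP => mvp.
rewrite (_ : p = fun t => v^-1 * (v * p t)); first exact: measurable_funM.
by apply/funext => t; rewrite mulKf// gt_eqF.
Qed.

Lemma zero_bias_density_tonelli (g : R -> \bar R) :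
  measurable_fun [set: R] g -> (forall t, 0 <= g t)%E ->
  (\int[lebesgue_measure]_t (g t * (v * p t)%:E) =
   \int[P]_w \int[lebesgue_measure]_t ((zero_bias_kernel (W w) t)%:E * g t))%E.
Proof.
move=> mg g0.
have mkg : measurable_fun [set: T * R] (fun z => kW z * g z.2)%E.
  by apply: emeasurable_funM => //; exact: measurableT_comp.
have kg0 z : (0 <= kW z * g z.2)%E.
  by rewrite mule_ge0// lee_fin zero_bias_kernel_ge0.
transitivity (\int[lebesgue_measure]_t \int[P]_w (kW (w, t) * g t))%E; last first.
  exact/esym/(@fubini_tonelli _ _ _ _ _ P lebesgue_measure _ mkg kg0).
apply: eq_integral => t _.
rewrite ge0_integralZr//.
- by rewrite zero_bias_kernel_mean muleC.
- exact: measurableT_comp (measurable_pair2 t).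
- by move=> w _; rewrite lee_fin zero_bias_kernel_ge0.
Qed.

(** Fubini's theorem for k(W, t) f'(t).  Absolute convergence of the integral
    of f' p makes k(w, .) f' integrable for almost every value w of W, so the
    fundamental theorem applies between 0 and w. *)
Lemma zero_bias_density_identity (f : R -> R) :
  (forall x, derivable f x 1) ->
  (@lebesgue_measure R).-integrable [set: R] (fun t => (derive1 f t * p t)%:E) ->
  P.-integrable [set: T] (fun w => (W w * (f (W w) - f 0))%:E) /\
  (\int[P]_w (W w * (f (W w) - f 0))%:E =
   v%:E * \int[lebesgue_measure]_t (derive1 f t * p t)%:E)%E.
Proof.
move=> df ifp.
have mf' := measurable_derive1 df.
have mf : measurable_fun [set: R] f.
  apply: continuous_measurable_fun => x.
  exact/differentiable_continuous/derivable1_diffP.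
pose F (z : T * R) : \bar R :=
  (zero_bias_kernel (W z.1) z.2 * derive1 f z.2)%:E.
have mF : measurable_fun [set: T * R] F.
  apply/measurable_EFinP/measurable_funM; last exact: measurableT_comp.
  exact/measurable_EFinP.
have iF : (P \x lebesgue_measure)%E.-integrable [set: T * R] F.
  apply/integrable12ltyP => //.
  have -> : (\int[P]_w \int[lebesgue_measure]_t `|F (w, t)| =
      \int[lebesgue_measure]_t (`|derive1 f t|%:E * (v * p t)%:E))%E.
    rewrite zero_bias_density_tonelli//.
    - apply: eq_integral => w _; apply: eq_integral => t _.
      by rewrite /F/= normrM EFinM ger0_norm// zero_bias_kernel_ge0.
    - by apply/measurable_EFinP; exact: measurableT_comp.
  have /integrableP[_] := integrableZl measurableT v ifp.
  apply: le_lt_trans; apply: ge0_le_integral => //=.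
  + by move=> t _; rewrite -EFinM lee_fin mulr_ge0// (mulr_ge0 (ltW v0))// zero_bias_density_ge0.
  + apply/measurable_EFinP; apply: measurable_funM; first exact: measurableT_comp.
    by apply: measurable_funM => //; exact: measurable_zero_bias_density.
  + apply/measurable_EFinP; apply: measurableT_comp => //.
    apply: measurable_funM => //; apply: measurable_funM => //.
    exact: measurable_zero_bias_density.
  + move=> t _; rewrite -EFinM lee_fin 2!normrM (gtr0_norm v0).
    by rewrite (ger0_norm (zero_bias_density_ge0 _)) mulrCA.
have FE : {ae P, forall w, (\int[lebesgue_measure]_t F (w, t) =
    (W w * (f (W w) - f 0))%:E)%E}.
  have := ae_integrable1 iF; apply: filterS => w /= iFw.
  exact: (@zero_bias_kernel_FTC R f (W w) df iFw).
have mWf : measurable_fun [set: T] (fun w => (W w * (f (W w) - f 0))%:E).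
  apply/measurable_EFinP; apply: measurable_funM => //.
  by apply: measurable_funB => //; exact: measurableT_comp.
have iWf : P.-integrable [set: T] (fun w => (W w * (f (W w) - f 0))%:E).
  apply/integrableP; split => //.
  have /integrableP[mFF] := integrable_fubini_F iF.
  rewrite (ae_eq_integral (fun w => `|(W w * (f (W w) - f 0))%:E|)%E) //.
  - exact: measurableT_comp.
  - exact: measurableT_comp.
  - by apply: filterS FE => w Hw _; rewrite -Hw.
split => //.
transitivity (\int[P]_w \int[lebesgue_measure]_t F (w, t))%E.
  apply: ae_eq_integral => //.
  - exact: (measurable_fubini_F iF).
  - by apply: filterS FE => w Hw _; exact/esym.
rewrite (Fubini iF) -integralZl//; apply: eq_integral => t _.
rewrite -EFinM mulrCA EFinM -zero_bias_kernel_mean.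
under eq_integral do rewrite /F/= mulrC EFinM.
have mkWt : measurable_fun [set: T] (fun w => (zero_bias_kernel (W w) t)%:E).
  exact: (measurableT_comp measurable_kW (measurable_pair2 t)).
rewrite integralZl//.
apply/integrableP; split => //.
under eq_integral do rewrite /= ger0_norm ?zero_bias_kernel_ge0//.
by rewrite zero_bias_kernel_mean ltry.
Qed.

End zero_bias_density_theory.

Lemma zero_bias_kernel_le (R : realType) (x t : R) :
  zero_bias_kernel x t <= `|x| * \1_`[- `|x|, `|x|] t.
Proof.
rewrite /zero_bias_kernel indicE mem_setE in_itv/=.
case: (ltP t x) => h1; case: (ltP t 0) => h2 /=; rewrite ?subrr ?mulr0 ?mulr_ge0//;
  case: (leP (- `|x|) t) => h3; case: (leP t `|x|) => h4 //=;
  have := ler_norm x; have := ler_norm (- x); rewrite normrN; lra.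
Qed.

Lemma integral_zero_bias_kernel_exp (R : realType) (x : R) (n : nat) :
  (\int[lebesgue_measure]_t (zero_bias_kernel x t * `|t| ^+ n)%:E
   <= (2 * `|x| ^+ (n + 2))%:E)%E.
Proof.
have mt : measurable_fun [set: R] (fun t : R => `|t| ^+ n).
  by apply: measurable_funX; exact: normr_measurable.
have mI : measurable_fun [set: R] (\1_`[- `|x|, `|x|] : R -> R).
  exact: measurable_indic.
apply: (@le_trans _ _ (\int[lebesgue_measure]_t
    ((`|x| ^+ n.+1)%:E * (\1_`[- `|x|, `|x|] t)%:E))%E).
  apply: ge0_le_integral => //=.
  - by move=> t _; rewrite lee_fin mulr_ge0 ?exprn_ge0// zero_bias_kernel_ge0.
  - apply/measurable_EFinP/measurable_funM.
      exact: (measurableT_comp (@measurable_zero_bias_kernel R) (measurable_pair1 x)).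
    exact: mt.
  - by apply/measurable_EFinP; exact: measurable_funM.
  - move=> t _; rewrite -EFinM lee_fin.
    apply: (@le_trans _ _ (`|x| * \1_`[- `|x|, `|x|] t * `|t| ^+ n)).
      by rewrite ler_wpM2r ?exprn_ge0// zero_bias_kernel_le.
    rewrite exprS -mulrA -[leRHS]mulrA ler_wpM2l// mulrC.
    rewrite indicE mem_setE in_itv/= -ler_norml.
    by case: (leP `|t| `|x|) => h; rewrite /= ?mulr0// !mulr1 lerXn2r// nnegrE.
rewrite ge0_integralZl//.
- rewrite integral_indic ?setIT//.
  rewrite [X in (_ * X)%E](lebesgue_measure_itv `[- `|x|, `|x|]) /= lte_fin.
  case: ifPn => _; rewrite -?EFinD -EFinM lee_fin; last by rewrite mulr0 mulr_ge0// exprn_ge0.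
  suff -> : 2 * `|x| ^+ (n + 2) = `|x| ^+ n.+1 * (`|x| - - `|x|) by [].
  by rewrite addn2 (exprS _ n.+1); ring.
exact/measurable_EFinP.
Qed.

(** By Tonelli's theorem the integral of |t|^n p(t) is controlled by the
    expectation of the integral of k(W, t) |t|^n, where |t| <= |W|.  The case
    n = 0 is the integrability of p. *)
Lemma zero_bias_density_moment d (T : measurableType d) (R : realType)
    (P : probability T R) (W : {RV P >-> R}) (v : R) (n : nat) :
  (W : T -> R) \in Lfun P 2%:E -> ('E_P[W] = 0)%E -> 0 < v ->
  ('V_P[W] = v%:E)%E ->
  P.-integrable [set: T] (fun w => (W w ^+ (n + 2))%:E) ->
  (@lebesgue_measure R).-integrable [set: R]
    (fun t => (t ^+ n * zero_bias_density P W t)%:E).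
Proof.
move=> W2 EW v0 VW iWn; set p := zero_bias_density P W.
have p0 t : 0 <= p t by exact: zero_bias_density_ge0 W2 EW v0 VW t.
have mp : measurable_fun [set: R] p.
  exact: measurable_zero_bias_density W2 EW v0 VW.
have mt : measurable_fun [set: R] (fun t : R => `|t| ^+ n).
  by apply: measurable_funX; exact: normr_measurable.
suff H : (\int[lebesgue_measure]_t ((`|t| ^+ n)%:E * (v * p t)%:E) < +oo)%E.
  have : (@lebesgue_measure R).-integrable [set: R]
      (fun t => v^-1%:E * (t ^+ n * (v * p t))%:E)%E.
    apply: integrableZl => //; apply/integrableP; split.
      apply/measurable_EFinP/measurable_funM; last exact: measurable_funM.
      exact: measurable_funX.
    apply: le_lt_trans H; apply: ge0_le_integral => //=.
    - apply/measurable_EFinP/measurableT_comp => //.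
      apply: measurable_funM; last exact: measurable_funM.
      exact: measurable_funX.
    - apply/measurable_EFinP/measurable_funM => //; exact: measurable_funM.
    - move=> t _; rewrite -EFinM lee_fin normrM normrX [X in _ * X]ger0_norm//.
      by rewrite mulr_ge0 ?p0// ltW.
  apply: eq_integrable => // t _; rewrite -EFinM; congr EFin.
  by field; rewrite gt_eqF.
rewrite (zero_bias_density_tonelli W2 EW v0 VW); last 2 first.
  exact/measurable_EFinP.
  by move=> t; rewrite lee_fin exprn_ge0.
have /integrableP[_] := integrableZl measurableT 2 iWn.
apply: le_lt_trans; apply: ge0_le_integral => //=.
- by move=> w _; apply: integral_ge0 => t _;
    rewrite -EFinM lee_fin mulr_ge0 ?exprn_ge0// zero_bias_kernel_ge0.
- have mF : measurable_fun [set: T * R]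
      (fun z => (zero_bias_kernel (W z.1) z.2)%:E * (`|z.2| ^+ n)%:E)%E.
    under eq_fun do rewrite -EFinM.
    apply/measurable_EFinP/measurable_funM.
      have mg : measurable_fun [set: T * R] (fun z => (W z.1, z.2)).
        by apply: measurable_fun_pair => //; exact: measurableT_comp.
      exact: (measurableT_comp (@measurable_zero_bias_kernel R) mg).
    exact: measurableT_comp mt measurable_snd.
  have F0 (z : T * R) :
      (0 <= (zero_bias_kernel (W z.1) z.2)%:E * (`|z.2| ^+ n)%:E)%E.
    by rewrite -EFinM lee_fin mulr_ge0 ?exprn_ge0// zero_bias_kernel_ge0.
  exact: (@measurable_fun_fubini_tonelli_F _ _ _ _ _ lebesgue_measure _ mF F0).
- apply/measurable_EFinP; apply: measurableT_comp => //.
  by apply: measurable_funM => //; exact: measurable_funX.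
- move=> w _; under eq_integral do rewrite -EFinM.
  apply: le_trans (integral_zero_bias_kernel_exp (W w) n) _.
  by rewrite lee_fin normrM normrX ger0_norm.
Qed.

(** * Test functions *)

(** A first order expansion with quadratic error determines the derivative.
    It treats the square of a positive part at all points alike. *)
Lemma is_derive_quadratic (R : realType) (f : R -> R) (x l C : R) :
  (forall h, `|f (h + x) - f x - l * h| <= C * h ^+ 2) -> is_derive x 1 f l.
Proof.
move=> H.
have C0 : 0 <= C.
  by have := le_trans (normr_ge0 _) (H 1); rewrite expr1n mulr1.
have cv : (fun h => h^-1 *: ((f \o shift x) (h *: (1 : R)) - f x)) @ 0^' --> l.
  apply/cvgrPdist_le => e e0; rewrite near_withinE; apply/nbhs_ballP.
  exists (e / (C + 1)) => /=; first by rewrite divr_gt0//; lra.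
  move=> h; rewrite /ball/= sub0r normrN => he h0.
  rewrite [h%:A]mulr1.
  have -> : l - h^-1 *: (f (h + x) - f x) = - (h^-1 * (f (h + x) - f x - l * h)).
    by rewrite /GRing.scale/=; field.
  rewrite normrN normrM normfV ler_pdivrMl ?normr_gt0//.
  rewrite (le_trans (H h))// -real_normK ?num_real// expr2 mulrA mulrC.
  rewrite ler_pM2l ?normr_gt0//.
  apply: (@le_trans _ _ ((C + 1) * `|h|)).
    by rewrite ler_wpM2r//; lra.
  by rewrite mulrC -ler_pdivlMr ?ltW//; lra.
split; first by apply/cvg_ex; exists l.
exact: cvg_lim cv.
Qed.

(** As n grows these functions increase to the indicator of the half-line
    ]x, +oo[, and they have explicit primitives. *)
Definition ramp (R : realType) (x : R) (n : nat) (t : R) : R :=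
  Num.min 1 (Num.max 0 (n.+1%:R * (t - x))).

Definition ramp_primitive (R : realType) (x : R) (n : nat) (t : R) : R :=
  n.+1%:R / 2 * ((Num.max 0 (t - x)) ^+ 2
    - (Num.max 0 (t - (x + n.+1%:R^-1))) ^+ 2).

Lemma is_derive_ramp_primitive (R : realType) (x : R) n (t : R) :
  is_derive t 1 (ramp_primitive x n) (ramp x n t).
Proof.
have n0 : 0 < n.+1%:R :> R by [].
have D (c : R) : is_derive t 1 (fun t => (Num.max 0 (t - c)) ^+ 2)
    (2 * Num.max 0 (t - c)).
  apply: (@is_derive_quadratic _ _ _ _ 1) => h.
  rewrite mul1r ler_norml.
  by case: (leP 0 (h + t - c)) => h1; case: (leP 0 (t - c)) => h2; nra.
have := is_deriveZ (n.+1%:R / 2) (is_deriveB (D x) (D (x + n.+1%:R^-1))).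
suff -> : ramp x n t = n.+1%:R / 2 *: (2 * Num.max 0 (t - x) -
    2 * Num.max 0 (t - (x + n.+1%:R^-1))) by [].
rewrite /ramp /GRing.scale/=.
have nV : n.+1%:R * n.+1%:R^-1 = 1 :> R by rewrite mulfV// gt_eqF.
have iV : 0 < n.+1%:R^-1 :> R by rewrite invr_gt0.
move: (n.+1%:R^-1) nV iV => i; move: (n.+1%:R) n0 => m m0 mi i0.
case: (leP 0 (t - x)) => h1; case: (leP 0 (t - (x + i))) => h2;
  case: (leP 0 (m * (t - x))) => h3; case: (leP 1 _) => h4; try nra.
Qed.

Lemma ramp_ge0 (R : realType) (x : R) n t : 0 <= ramp x n t.
Proof. by rewrite /ramp le_min ler01 le_max lexx. Qed.

Lemma ramp_le1 (R : realType) (x : R) n t : ramp x n t <= 1.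
Proof. by rewrite /ramp ge_min lexx. Qed.

Lemma continuous_ramp (R : realType) (x : R) n : continuous (ramp x n).
Proof.
move=> t; pose lin (u : R) : R := n.+1%:R * (u - x).
have clin : {for t, continuous lin}.
  apply: cvgM; first exact: cvg_cst.
  by apply: (@cvgB _ R^o); [exact: cvg_id|exact: cvg_cst].
have c1 : {for t, continuous (fun=> 1 : R)} by exact: cvg_cst.
have c0 : {for t, continuous (fun=> 0 : R)} by exact: cvg_cst.
exact: (continuous_min c1 (continuous_max c0 clin)).
Qed.

Lemma ramp_nondecreasing (R : realType) (x t : R) : nondecreasing_seq (ramp x ^~ t).
Proof.
move=> m n mn; rewrite /ramp.
rewrite le_min ge_min lexx /= ge_min; apply/orP; right.
have [tx|tx] := leP 0 (t - x).
  by rewrite le_max; apply/orP; right; rewrite ge_max mulr_ge0//= ler_wpM2r// ler_nat.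
by rewrite le_max; apply/orP; left; rewrite ge_max lexx/= pmulr_rle0// ltW.
Qed.

Lemma cvg_ramp (R : realType) (x t : R) :
  ramp x n t @[n --> \oo] --> (\1_`]x, +oo[ t : R).
Proof.
rewrite indicE (_ : (t \in _) = (x < t)); last by rewrite mem_setE in_itv/= andbT.
case: ltP => xt.
  have tx : 0 < t - x by rewrite subr_gt0.
  apply/cvgrPdist_le => e e0; near=> n.
  rewrite (_ : ramp x n t = 1) ?subrr ?normr0 ?ltW//.
  apply/min_idPl; rewrite le_max; apply/orP; right.
  rewrite mulrC -ler_pdivrMl// mulr1 -[leRHS]invrK lef_pV2 ?posrE ?invr_gt0//.
  apply: ltW; near: n; exact: near_infty_natSinv_lt (PosNum tx).
apply: cvg_near_cst; apply: nearW => n.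
rewrite /ramp (_ : Num.max _ _ = 0); first by apply/min_idPr.
by apply/max_idPl; rewrite pmulr_rle0// subr_le0.
Unshelve. all: by end_near. Qed.

(** By monotone convergence the two measures agree on the half-lines
    ]x, +oo[, which are stable under intersection and generate the Borel
    sets. *)
Lemma measure_eq_ramp (R : realType) (m1 m2 : {measure set (measurableTypeR R) -> \bar R}) :
  (m1 setT < +oo)%E ->
  (forall x n, \int[m1]_t (ramp x n t)%:E = \int[m2]_t (ramp x n t)%:E)%E ->
  forall A, measurable A -> m1 A = m2 A.
Proof.
move=> m1oo H.
have mr x n : measurable_fun [set: R] (EFin \o (@ramp R x n)).
  by apply/measurable_EFinP; apply: continuous_measurable_fun; exact: continuous_ramp.
have lim_ray (m : {measure set (measurableTypeR R) -> \bar R}) (x : R) :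
    m `]x, +oo[%classic = lim ((\int[m]_t (ramp x n t)%:E)%E @[n --> \oo]).
  rewrite -monotone_convergence//.
  - rewrite -[in LHS](setIT `]x, +oo[%classic) -integral_indic//.
    by apply: eq_integral => t _; apply/esym/cvg_lim => //; apply: cvg_EFin;
       [exact: nearW|exact: cvg_ramp].
  - by move=> n; exact: mr.
  - by move=> n t _; rewrite lee_fin ramp_ge0.
  - by move=> t _ a b ab; rewrite lee_fin ramp_nondecreasing.
have rays (x : R) : m1 `]x, +oo[%classic = m2 `]x, +oo[%classic.
  by rewrite !lim_ray; apply: congr_lim; apply/funext => n; exact: H.
apply: (@measure_unique _ R (measurableTypeR R) (@RGenOInfty.G R) (fun n => `]- n%:R, +oo[%classic)).
- exact: RGenOInfty.measurableE.
- move=> _ _ [x ->] [y ->]; exists (Num.max x y).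
  apply/seteqP; split => z /=; rewrite !in_itv/= !andbT gt_max.
    by move=> [-> ->].
  by move=> /andP[].
- by move=> n; eexists; reflexivity.
- rewrite -subTset => z _; exists (Num.truncn `|z|).+1 => //=.
  rewrite in_itv/= andbT ltrNl.
  by rewrite (le_lt_trans (ler_norm _))// normrN truncnS_gt.
- by move=> _ [x ->].
- by move=> n; apply: le_lt_trans m1oo; apply: le_measure => //; rewrite inE.
Qed.

(** The bound on the derivative makes f Lipschitz, so that f(W) is as
    integrable as W; its sign allows Tonelli's theorem on the side of f'. *)
Definition test_function (R : realType) (f : R -> R) :=
  [/\ forall x, derivable f x 1, continuous (derive1 f) &
      forall x, 0 <= derive1 f x <= 1].

Section test_function_lemmas.
Context (R : realType) (f : R -> R).
Hypothesis tf : test_function f.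

Lemma test_continuous : continuous f.
Proof.
by case: tf => df _ _ x; exact/differentiable_continuous/derivable1_diffP.
Qed.

Lemma test_measurable : measurable_fun [set: R] f.
Proof. by apply: continuous_measurable_fun; exact: test_continuous. Qed.

Lemma test_measurable_derive1 : measurable_fun [set: R] (derive1 f).
Proof. by case: tf => ? cf' _; exact: continuous_measurable_fun. Qed.

Lemma test_derive1_ge0 x : 0 <= derive1 f x.
Proof. by case: tf => _ _ /(_ x)/andP[]. Qed.

Lemma test_lipschitz x y : `|f x - f y| <= `|x - y|.
Proof.
wlog xy : x y / x <= y.
  move=> H; have [/H//|/ltW/H] := leP x y.
  by rewrite distrC [leRHS]distrC.
have [df _ f'01] := tf.
move: xy; rewrite le_eqVlt => /predU1P[->|xy]; first by rewrite !subrr normr0.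
have [||c _ E] := @MVT _ f (derive1 f) _ _ xy.
- by move=> z _; rewrite derive1E; exact: derivableP.
- by apply: continuous_subspaceT; exact: test_continuous.
rewrite distrC [leRHS]distrC E normrM ler_piMl//.
by rewrite ger0_norm; have /andP[] := f'01 c.
Qed.

Lemma test_linear_growth x : `|f x| <= `|f 0| + `|x|.
Proof.
rewrite -[X in `|X| <= _](subrK (f 0)) (le_trans (ler_normD _ _))// addrC lerD2l.
by rewrite -[X in _ <= `|X|]subr0 test_lipschitz.
Qed.

Lemma integrable_test_derive1 d (T : measurableType d) (Q : probability T R)
    (Y : T -> R) : measurable_fun [set: T] Y ->
  Q.-integrable [set: T] (fun w => (derive1 f (Y w))%:E).
Proof.
move=> mY; have [_ _ f'01] := tf.
have i1 : Q.-integrable [set: T] (EFin \o cst (1 : R)).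
  by apply: finite_measure_integrable_cst; exact: measurableT.
apply: le_integrable i1 => //.
- by apply/measurable_EFinP; exact: measurableT_comp test_measurable_derive1 mY.
- move=> w _ /=; rewrite lee_fin normr1 ger0_norm ?test_derive1_ge0//.
  by have /andP[] := f'01 (Y w).
Qed.

End test_function_lemmas.

Lemma test_ramp (R : realType) (x : R) n : test_function (ramp_primitive x n).
Proof.
have E : derive1 (ramp_primitive x n) = ramp x n.
  apply/funext => t; rewrite derive1E.
  by have [_ <-] := is_derive_ramp_primitive x n t.
split.
- by move=> t; have [] := is_derive_ramp_primitive x n t.
- by rewrite E; exact: continuous_ramp.
- by move=> t; rewrite E ramp_ge0 ramp_le1.
Qed.

Lemma integrable_mul_linear_growth d (T : measurableType d) (R : realType)
    (P : probability T R) (W : T -> R) (g : R -> R) (C : R) :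
  W \in Lfun P 2%:E -> measurable_fun [set: R] g ->
  (forall x, `|g x| <= C + `|x|) ->
  P.-integrable [set: T] (fun w => (W w * g (W w))%:E).
Proof.
move=> W2 mg gC.
have mW : measurable_fun [set: T] W by have := sub_Lfun_mfun W2; rewrite inE.
have iW : P.-integrable [set: T] (EFin \o W).
  by apply/Lfun1_integrable; rewrite Lfun_subset12// fin_num_measure.
have iWW : P.-integrable [set: T] (EFin \o (fun w => C * `|W w| + W w ^+ 2)).
  rewrite (_ : EFin \o _ = (fun w => C%:E * (abse \o (EFin \o W)) w
      + (EFin \o (fun w => W w ^+ 2)%R) w)%E); last first.
    by apply/funext => w /=; rewrite EFinD EFinM.
  apply: integrableD => //.
    by apply: integrableZl => //; exact: integrable_abse.
  by have := Lfun2_integrable_sqr W2.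
apply: le_integrable iWW => //.
- apply/measurable_EFinP; apply: measurable_funM => //.
  exact: measurableT_comp.
- move=> w _ /=; rewrite lee_fin normrM.
  apply: (@le_trans _ _ (`|W w| * (C + `|W w|))); first by rewrite ler_wpM2l.
  by rewrite mulrDr mulrC -expr2 real_normK ?num_real// ler_norm.
Qed.

(** * The zero biased law is the law with the zero bias density *)

Section zero_bias_characterization.
Context d (T : measurableType d) (R : realType) (P : probability T R).
Variables (W : {RV P >-> R}) (v : R).
Hypothesis W2 : (W : T -> R) \in Lfun P 2%:E.
Hypothesis EW : ('E_P[W] = 0)%E.
Hypothesis v0 : 0 < v.
Hypothesis VW : ('V_P[W] = v%:E)%E.
Context d' (T' : measurableType d') (Q : probability T' R) (Ws : {RV Q >-> R}).

Let p := zero_bias_density P W.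
Let mp : measurable_fun [set: R] p := measurable_zero_bias_density W2 EW v0 VW.
Let p0 : forall x, 0 <= p x := zero_bias_density_ge0 W2 EW v0 VW.

(** The constant f 0 contributes f 0 times E W = 0. *)
Lemma expectation_mul_recenter (f : R -> R) :
  P.-integrable [set: T] (fun w => (W w * (f (W w) - f 0))%:E) ->
  (\int[P]_w (W w * f (W w))%:E = \int[P]_w (W w * (f (W w) - f 0))%:E)%E.
Proof.
move=> iWf; have iW := L2_integrable W2.
have -> : (fun w => (W w * f (W w))%:E) = (fun w => (W w * (f (W w) - f 0))%:E
    + (f 0)%:E * (EFin \o W) w)%E.
  by apply/funext => w; rewrite /= -EFinM -EFinD; congr EFin; ring.
rewrite integralD//; last exact: integrableZl.
rewrite integralZl// (_ : \int[P]_w (EFin \o W) w = 0)%E ?mule0 ?adde0//.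
by move: EW; rewrite unlock.
Qed.

Lemma has_density_zero_biased :
  has_density (distribution Q Ws) p -> zero_biased P W Q Ws.
Proof.
move=> Wsp; split; first exact: measurable_funPT.
move=> f df iWf if'; rewrite unlock VW.
have mf' := measurable_derive1 df.
have [if'p f'p] := has_density_expectation Wsp mf' if'.
have [iWf0 Wf0] := zero_bias_density_identity W2 EW v0 VW df if'p.
by rewrite expectation_mul_recenter// Wf0 f'p.
Qed.

Lemma zero_biased_test (f : R -> R) : test_function f -> zero_biased P W Q Ws ->
  (\int[P]_w (W w * f (W w))%:E = v%:E * \int[Q]_w (derive1 f (Ws w))%:E)%E.
Proof.
move=> tf [mWs Hf]; have [df _ _] := tf.
have iWf : P.-integrable [set: T] (fun w => (W w * f (W w))%:E).
  apply: integrable_mul_linear_growth W2 _ _; first exact: test_measurable.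
  exact: test_linear_growth.
have := Hf f df iWf (integrable_test_derive1 tf Q mWs).
by rewrite unlock VW.
Qed.

(** Applied to the primitives of the ramps, the hypothesis says that the law
    of Ws and the measure with density p integrate every ramp alike. *)
Lemma test_has_density :
  (forall f, test_function f ->
    \int[P]_w (W w * f (W w))%:E = v%:E * \int[Q]_w (derive1 f (Ws w))%:E)%E ->
  has_density (distribution Q Ws) p.
Proof.
move=> H; split => //.
apply: (@measure_eq_ramp R (distribution Q (borel_rv Ws))
  (density_measure lebesgue_measure mp p0)).
  by apply: le_lt_trans (ltry 1); exact: probability_le1.
move=> x n; have tf := test_ramp x n.
have E : derive1 (ramp_primitive x n) = ramp x n.
  apply/funext => t; rewrite derive1E.
  by have [_ <-] := is_derive_ramp_primitive x n t.
have mr : measurable_fun [set: R] (EFin \o ramp x n).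
  by apply/measurable_EFinP; rewrite -E; exact: test_measurable_derive1.
have r0 t : (0 <= (EFin \o ramp x n) t)%E by rewrite lee_fin ramp_ge0.
rewrite ge0_integral_distribution//.
rewrite (@ge0_integral_density _ _ _ lebesgue_measure
  (density_measure lebesgue_measure mp p0) p (EFin \o ramp x n))//.
have mrp : measurable_fun [set: R] (fun t => (ramp x n t * p t)%:E).
  by apply/measurable_EFinP/measurable_funM => //; apply/measurable_EFinP.
have ip : (@lebesgue_measure R).-integrable [set: R] (fun t => (t ^+ 0 * p t)%:E).
  apply: zero_bias_density_moment W2 EW v0 VW _.
  exact: Lfun2_integrable_sqr.
have irp : (@lebesgue_measure R).-integrable [set: R]
    (fun t => (derive1 (ramp_primitive x n) t * p t)%:E).
  rewrite E; apply: le_integrable ip => //.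
  move=> t _; rewrite /= lee_fin expr0 !normrM ler_wpM2r// normr1.
  by rewrite ger0_norm ?ramp_ge0// ramp_le1.
have [df _ _] := tf.
have [iWf Wf] := zero_bias_density_identity W2 EW v0 VW df irp.
have := H _ tf; rewrite expectation_mul_recenter// Wf E.
move=> /(congr1 (fun z => (v^-1)%:E * z)%E).
by rewrite !muleA -!EFinM mulVf ?gt_eqF// !mul1e => <-.
Qed.

End zero_bias_characterization.

(** * Symmetry and moments *)

Section zero_biased_consequences.
Context d (T : measurableType d) (R : realType) (P : probability T R).
Variables (W : {RV P >-> R}) (v : R).
Hypothesis W2 : (W : T -> R) \in Lfun P 2%:E.
Hypothesis EW : ('E_P[W] = 0)%E.
Hypothesis v0 : 0 < v.
Hypothesis VW : ('V_P[W] = v%:E)%E.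
Context d' (T' : measurableType d') (Q : probability T' R).

Lemma zero_biased_has_density (Ws : {RV Q >-> R}) : zero_biased P W Q Ws ->
  has_density (distribution Q Ws) (zero_bias_density P W).
Proof.
move=> zb; apply: (test_has_density W2 EW v0 VW) => f tf.
exact: zero_biased_test.
Qed.

(** If W is symmetric, the identity for g(x) = - f(- x) is the identity for f
    with - Ws in place of Ws.  So - Ws is also zero biased for W, and both
    variables have the zero bias density. *)
Lemma zero_biased_symmetric (Ws : {RV Q >-> R}) : zero_biased P W Q Ws ->
  symmetric_law (distribution P W) -> symmetric_law (distribution Q Ws).
Proof.
move=> zb symW.
have WN : same_law (distribution P W) (distribution P (\- W)%R).
  by move=> A mA; rewrite -symW.
have zbN : zero_biased P W Q (\- Ws)%R.
  split; first exact: measurable_funPT.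
  move=> f df iWf if'.
  have mf : measurable_fun [set: R] f.
    apply: continuous_measurable_fun => x.
    exact/differentiable_continuous/derivable1_diffP.
  have mxf : measurable_fun [set: R] (fun x => x * f x) by exact: measurable_funM.
  have [iWfN EWfN] := same_law_expectation WN mxf iWf.
  pose g x := - f (- x).
  have dg (x : R) : is_derive x 1 g (derive1 f (- x)).
    have dfx : is_derive (- x) 1 f (derive1 f (- x)).
      by rewrite derive1E; exact: derivableP.
    have dN : is_derive x 1 (fun y : R => - y) (- 1) by apply: is_deriveN.
    have := is_deriveN (@is_derive1_comp _ f (fun y : R => - y) x _ _ dfx dN).
    by rewrite mulrN1 opprK.
  have g'E x : derive1 g x = derive1 f (- x).
    by rewrite derive1E; have [_ <-] := dg x.
  have [_ /(_ g)] := zb.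
  have -> : (fun w => (W w * g (W w))%:E) =
      (fun w => ((\- W)%R w * f ((\- W)%R w))%:E).
    by apply/funext => w; rewrite /g/= mulNr mulrN.
  have -> : (fun w => (derive1 g (Ws w))%:E) =
      (fun w => (derive1 f ((\- Ws)%R w))%:E).
    by apply/funext => w; rewrite g'E.
  move=> /(_ (fun x => let: DeriveDef d _ := dg x in d) iWfN if').
  have -> : (fun w => W w * g (W w)) = (fun w => (\- W)%R w * f ((\- W)%R w)).
    by apply/funext => w; rewrite /g/= mulNr mulrN.
  have -> : (fun w => derive1 g (Ws w)) = (fun w => derive1 f ((\- Ws)%R w)).
    by apply/funext => w; rewrite g'E.
  move=> <-; rewrite unlock; exact/esym/EWfN.
have [_ _ DN] := zero_biased_has_density zbN.
have [_ _ D] := zero_biased_has_density zb.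
move=> A mA; transitivity (distribution Q (\- Ws)%R A); first by [].
by rewrite DN// D.
Qed.

(** The identity for f(x) = x^(n+1) / (n+1), which is available because the
    n-th moment of Ws is an integral against the zero bias density. *)
Lemma zero_biased_moment (Ws : {RV Q >-> R}) (n : nat) : zero_biased P W Q Ws ->
  P.-integrable [set: T] (fun w => (W w ^+ (n + 2))%:E) ->
  Q.-integrable [set: T'] (fun w => (Ws w ^+ n)%:E) /\
  (v%:E * 'E_Q[fun w => (Ws w ^+ n)%R] =
     'E_P[fun w => (W w ^+ (n + 2))%R] * ((n + 1)%:R^-1)%:E)%E.
Proof.
move=> zb iW.
have D := zero_biased_has_density zb.
have iWs : Q.-integrable [set: T'] (fun w => (Ws w ^+ n)%:E).
  have mX : measurable_fun [set: R] (fun x : R => (`|x ^+ n|)%:E : \bar R).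
    by apply/measurable_EFinP; apply: measurableT_comp => //; exact: measurable_funX.
  apply/integrableP; split.
    by apply/measurable_EFinP; exact: measurable_funX.
  rewrite (ge0_has_density_expectation D mX)//.
  have /integrableP[_] := zero_bias_density_moment W2 EW v0 VW iW.
  congr (_ < _)%E; apply: eq_integral => t _.
  rewrite -EFinM /= normrM [X in _ * X]ger0_norm//.
  exact: zero_bias_density_ge0 W2 EW v0 VW t.
split => //.
pose f (x : R) := (n.+1%:R)^-1 * x ^+ n.+1.
have n0 : n.+1%:R != 0 :> R by rewrite pnatr_eq0.
have dX (x : R) : is_derive x 1 f (x ^+ n).
  have := is_deriveZ (n.+1%:R)^-1 (is_deriveX n.+1 (is_derive_id x 1)).
  rewrite (_ : n.+1%:R^-1 \*: _ = f); last first.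
    by apply/funext => y; rewrite /f !fctE.
  by rewrite /GRing.scale/= mulr1 mulKf.
have f'E : derive1 f = fun x => x ^+ n.
  by apply/funext => x; rewrite derive1E; have [_ <-] := dX x.
have [_ /(_ f)] := zb; rewrite f'E.
have -> : (fun w => (W w * f (W w))%:E) =
    (fun w => (n.+1%:R^-1)%:E * (W w ^+ (n + 2))%:E)%E.
  by apply/funext => w; rewrite -EFinM /f mulrCA addn2 -exprS.
move=> /(_ (fun x => let: DeriveDef d _ := dX x in d) (integrableZl measurableT _ iW) iWs).
rewrite VW => <-; rewrite unlock.
rewrite addn1 muleC -integralZl//; apply: eq_integral => w _.
by rewrite -EFinM /f mulrCA addn2 -exprS.
Qed.

End zero_biased_consequences.

(** * Shape and boundedness of the zero bias density *)

Lemma zero_bias_kernel_noninc (R : realType) (w s t : R) : 0 <= s -> s <= t ->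
  zero_bias_kernel w t <= zero_bias_kernel w s.
Proof.
rewrite /zero_bias_kernel => s0 st; have t0 := le_trans s0 st.
case: (ltP s w) => h1; case: (ltP t w) => h2;
  case: (ltP s 0) => h3; case: (ltP t 0) => h4 /=; nra.
Qed.

Lemma zero_bias_kernel_nondec (R : realType) (w s t : R) : t < 0 -> s <= t ->
  zero_bias_kernel w s <= zero_bias_kernel w t.
Proof.
rewrite /zero_bias_kernel => t0 st; have s0 := le_lt_trans st t0.
case: (ltP s w) => h1; case: (ltP t w) => h2;
  case: (ltP s 0) => h3; case: (ltP t 0) => h4 /=; nra.
Qed.

Section zero_bias_density_shape.
Context d (T : measurableType d) (R : realType) (P : probability T R).
Variables (W : {RV P >-> R}) (v : R).
Hypothesis W2 : (W : T -> R) \in Lfun P 2%:E.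
Hypothesis EW : ('E_P[W] = 0)%E.
Hypothesis v0 : 0 < v.
Hypothesis VW : ('V_P[W] = v%:E)%E.

Let p := zero_bias_density P W.
Let p0 : forall x, 0 <= p x := zero_bias_density_ge0 W2 EW v0 VW.
Let pE := zero_bias_kernel_mean W2 EW v0 VW.

Lemma measurable_zero_bias_kernel_RV t :
  measurable_fun [set: T] (fun w => (zero_bias_kernel (W w) t)%:E).
Proof.
apply/measurable_EFinP.
have mg : measurable_fun [set: T] (fun w => (W w, t)).
  exact: measurable_fun_pair.
exact: (measurableT_comp (@measurable_zero_bias_kernel R) mg).
Qed.

Lemma zero_bias_density_le s t :
  (forall w, zero_bias_kernel (W w) s <= zero_bias_kernel (W w) t) ->
  p s <= p t.
Proof.
move=> k_le; rewrite -(ler_pM2l v0) -lee_fin -!pE.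
apply: ge0_le_integral => //=.
- by move=> w _; rewrite lee_fin zero_bias_kernel_ge0.
- exact: measurable_zero_bias_kernel_RV.
- exact: measurable_zero_bias_kernel_RV.
- by move=> w _; rewrite lee_fin.
Qed.

Lemma zero_bias_density_noninc s t : 0 <= s -> s <= t -> p t <= p s.
Proof. by move=> s0 st; apply: zero_bias_density_le => w; exact: zero_bias_kernel_noninc. Qed.

Lemma zero_bias_density_nondec s t : t < 0 -> s <= t -> p s <= p t.
Proof. by move=> t0 st; apply: zero_bias_density_le => w; exact: zero_bias_kernel_nondec. Qed.

Lemma zero_bias_density_unimodal : unimodal_about0 p.
Proof.
split=> x y; rewrite !in_itv/= ?andbT => x0 y0 xy.
  exact: zero_bias_density_nondec.
by apply: zero_bias_density_noninc => //; exact: ltW.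
Qed.

(** The positivity set of p is an interval because p increases up to 0 and
    decreases from 0 on. *)
Lemma zero_bias_density_gt0_interval s t u : 0 < p s -> 0 < p u ->
  s <= t -> t <= u -> 0 < p t.
Proof.
move=> ps pu st tu; have [t0|t0] := ltP t 0.
  exact: lt_le_trans ps (zero_bias_density_nondec t0 st).
exact: lt_le_trans pu (zero_bias_density_noninc t0 tu).
Qed.

Lemma zero_bias_density_eq0P t :
  p t = 0 <-> {ae P, forall w, zero_bias_kernel (W w) t = 0}.
Proof.
have mk := measurable_zero_bias_kernel_RV t.
have k0 w : setT w -> (0 <= (zero_bias_kernel (W w) t)%:E)%E.
  by rewrite lee_fin zero_bias_kernel_ge0.
have E : (\int[P]_w `|(zero_bias_kernel (W w) t)%:E| = (v * p t)%:E)%E.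
  by rewrite -pE; apply: eq_integral => w _; rewrite gee0_abs// k0.
split => [pt0|k_eq0].
  have := (ae_eq_integral_abs P measurableT mk).1.
  rewrite E pt0 mulr0 => /(_ erefl); apply: filterS => w /(_ Logic.I).
  by case.
have := (ae_eq_integral_abs P measurableT mk).2; rewrite E.
move=> H; have : ((v * p t)%:E = 0)%E.
  by apply: H; apply: filterS k_eq0 => w kw0 _; rewrite kw0.
by case=> /eqP; rewrite mulf_eq0 gt_eqF//= => /eqP.
Qed.

Let mgt t : measurable [set w | t < W w].
Proof.
rewrite (_ : [set w | _] = W @^-1` `]t, +oo[); first exact: measurable_funPTI.
by apply/seteqP; split => w /=; rewrite in_itv/= andbT.
Qed.

Let mle t : measurable [set w | W w <= t].
Proof.
rewrite (_ : [set w | _] = W @^-1` `]-oo, t]); first exact: measurable_funPTI.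
by apply/seteqP; split => w /=; rewrite in_itv/=.
Qed.

Lemma zero_bias_density_gt0_right (t : R) :
  0 <= t -> (0 < P [set w | (t < W w)%R])%E -> 0 < p t.
Proof.
move=> t0 Pt; rewrite lt_neqAle p0 andbT eq_sym; apply/eqP.
move=> /zero_bias_density_eq0P/(negligibleS _) k0.
have : P.-negligible [set w | t < W w].
  apply: k0 => w /= tw; rewrite /zero_bias_kernel tw (ltNge t 0) t0/= subr0 mulr1.
  by move=> w0; move: tw; rewrite w0 ltNge t0.
by move/negligibleP => /(_ (mgt t)) E; rewrite E ltxx in Pt.
Qed.

Lemma zero_bias_density_gt0_left (t : R) :
  t < 0 -> (0 < P [set w | (W w <= t)%R])%E -> 0 < p t.
Proof.
move=> t0 Pt; rewrite lt_neqAle p0 andbT eq_sym; apply/eqP.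
move=> /zero_bias_density_eq0P/(negligibleS _) k0.
have : P.-negligible [set w | W w <= t].
  apply: k0 => w /= tw; rewrite /zero_bias_kernel t0 (ltNge t) tw/= sub0r mulrN1.
  move=> /eqP; rewrite oppr_eq0 => /eqP w0.
  by move: tw; rewrite w0 leNgt t0.
by move/negligibleP => /(_ (mle t)) E; rewrite E ltxx in Pt.
Qed.

(** If W were almost surely on one side of t, then [t < W] would be almost
    surely a constant b, and E k(W, t) would be a multiple of E W = 0. *)
Lemma zero_bias_density_tails (t : R) : 0 < p t ->
  (0 < P [set w | (t < W w)%R])%E /\ (0 < P [set w | (W w <= t)%R])%E.
Proof.
move=> pt; have iW := L2_integrable W2.
have EW0 : (\int[P]_w (W w)%:E = 0)%E by move: EW; rewrite unlock.
have ind w : (t < W w)%R%:R = 1 - (W w <= t)%R%:R :> R.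
  by rewrite leNgt; case: (t < W w) => /=; rewrite ?subr0 ?subrr.
have contra (b : R) : b * b = b -> {ae P, forall w, (t < W w)%R%:R = b} -> False.
  move=> bb Hb.
  have : (\int[P]_w (zero_bias_kernel (W w) t)%:E =
      \int[P]_w ((b - (t < 0)%R%:R)%:E * (W w)%:E))%E.
    apply: ae_eq_integral => //.
    - exact: measurable_zero_bias_kernel_RV.
    - by apply: emeasurable_funM => //; exact/measurable_EFinP.
    - by apply: filterS Hb => w Hw _; rewrite /zero_bias_kernel Hw mulrC EFinM.
  rewrite pE integralZl// EW0 mule0 => -[/eqP].
  by rewrite mulf_eq0 !gt_eqF.
split; rewrite lt0e measure_ge0 andbT; apply/eqP => /(negligibleP _).
- move=> /(_ (mgt t)) N; apply: (contra 0); first by rewrite mulr0.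
  apply: negligibleS N => w /= Hw; apply: contrapT => tw; apply: Hw.
  by case: (t < W w) tw.
- move=> /(_ (mle t)) N; apply: (contra 1); first by rewrite mulr1.
  apply: negligibleS N => w /= Hw; rewrite leNgt; apply/negP => tw; apply: Hw.
  by rewrite tw.
Qed.

Context d' (T' : measurableType d') (Q : probability T' R) (Ws : {RV Q >-> R}).
Hypothesis Wsp : has_density (distribution Q Ws) p.

Let nuE (A : set R) : measurable A ->
  Q (Ws @^-1` A) = (\int[lebesgue_measure]_(x in A) (p x)%:E)%E.
Proof. by case: Wsp => _ _; exact. Qed.

(** If |W| <= M almost surely, then k(W, t) = 0 almost surely for |t| > M,
    and the density vanishes there. *)
Lemma zero_biased_bounded : as_bounded P W -> as_bounded Q Ws.
Proof.
move=> [M bM]; exists M.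
have pM t : M < `|t| -> p t = 0.
  move=> Mt; apply/zero_bias_density_eq0P; apply: filterS bM => w wM.
  apply/eqP; rewrite eq_le zero_bias_kernel_ge0 andbT.
  apply: le_trans (zero_bias_kernel_le _ _) _.
  rewrite indicE mem_setE in_itv/= -ler_norml.
  by rewrite (leNgt `|t|) (le_lt_trans wM Mt) mulr0.
have mA : measurable [set x : R | M < `|x|].
  rewrite (_ : [set x | _] = Num.norm @^-1` `]M, +oo[).
    by rewrite -[X in measurable X]setTI; exact: normr_measurable.
  by apply/seteqP; split => w /=; rewrite in_itv/= andbT.
have : Q (Ws @^-1` [set x : R | M < `|x|]) = 0%E.
  by rewrite nuE// integral0_eq// => x /= /pM ->.
move=> /(negligibleP Q (measurable_funPTI Ws mA)).
by apply: negligibleS => w /= /negP; rewrite -ltNge.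
Qed.

End zero_bias_density_shape.

(** * Support of the zero biased law *)

Lemma convex_setR_intervalP (R : realType) (C : set R) :
  convex_set (C : set R^o) <->
  (forall x y z, C x -> C y -> x <= z -> z <= y -> C z).
Proof.
split => [cC x y z Cx Cy xz zy|iC x y k].
  have [xy|nxy] := eqVneq x y; first by have -> : z = x by lra.
  have xy : x < y by rewrite lt_neqAle nxy (le_trans xz zy).
  have yx0 : y - x != 0 by rewrite subr_eq0 eq_sym.
  pose k0 := (y - z) / (y - x).
  have k00 : 0 <= k0 by rewrite divr_ge0// subr_ge0// ltW.
  have k01 : k0 <= 1 by rewrite ler_pdivrMr ?subr_gt0// mul1r lerB.
  pose k : {i01 R} := Itv01 k00 k01.
  have := cC x y k (mem_set Cx) (mem_set Cy); rewrite inE.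
  rewrite [X in C X](_ : _ = z)//; apply: etrans (convRE _ _ _) _.
  transitivity (k0 * x + (1 - k0) * y); first by [].
  by rewrite /k0; field.
rewrite !inE => Cx Cy.
have [k0 k1] : 0 <= k%:num /\ k%:num <= 1 by rewrite ge0 le1.
rewrite [X in C X](_ : _ = k%:num * (x : R) + (1 - k%:num) * (y : R))//.
move: (k%:num) k0 k1 => c c0 c1.
have [xy|yx] := leP (x : R) (y : R).
  by apply: iC Cx Cy _ _; nra.
by apply: iC Cy Cx _ _; nra.
Qed.

Lemma open_ballR (R : realType) (U : set R) (x : R) : open U -> U x ->
  exists2 e : R, 0 < e & forall y, x - e < y -> y < x + e -> U y.
Proof.
rewrite openE => oU Ux; have [e /= e0 He] := oU _ Ux.
by exists e => // y xy yx; apply: He; rewrite /ball/= ltr_distlC xy yx.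
Qed.

Section support_of_random_variable.
Context d (T : measurableType d) (R : realType) (P : probability T R).
Variable W : {RV P >-> R}.

Let mW (A : set R) : measurable A -> measurable (W @^-1` A).
Proof. by move=> mA; exact: measurable_funPTI. Qed.

Lemma closed_law_support : closed (law_support (distribution P W)).
Proof.
rewrite -[X in closed X]setCK; apply: open_closedC; rewrite openE => x /= nSx.
have [U [oU Ux nU]] : exists U : set R,
    [/\ open U, U x & ~ (0 < distribution P W U)%E].
  apply: contrapT => nE; apply: nSx => U oU Ux; apply: contrapT => nU.
  by apply: nE; exists U.
have [e e0 He] := open_ballR oU Ux.
exists e => //= y; rewrite /ball/= ltr_distlC => /andP[xy yx] Sy.
by apply: nU; apply: Sy => //; exact: He.
Qed.

(** The infimum s of the y such that W charges ]a, y] is in the support: W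
    does not charge ]a, s - e], so it charges ]s - e, y] for some y < s + e. *)
Lemma interval_meets_support (a b : R) :
  (0 < P (W @^-1` `]a, b]))%E ->
  exists s, [/\ a <= s, s <= b & law_support (distribution P W) s].
Proof.
move=> Pab; pose E := [set y | [/\ a <= y, y <= b & (0 < P (W @^-1` `]a, y]))%E]].
have ab : a < b.
  rewrite ltNge; apply/negP => ba; move: Pab.
  by rewrite set_itv_ge ?bnd_simp -?leNgt// preimage_set0 measure0 ltxx.
have Eb : E b by split => //; exact: ltW.
have hE : has_inf E by split; [exists b|exists a => y []].
pose s := inf E.
have as_ : a <= s by apply: lb_le_inf => //; [exists b|move=> y []].
have sb : s <= b by apply: ge_inf => //; exists a => y [].
exists s; split => // U oU Us.
have [e e0 He] := open_ballR oU Us.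
have [y [ay yb Py] yse] := inf_adherent e0 hE.
apply: (@lt_le_trans _ _ (P (W @^-1` `]s - e, y]))); last first.
  apply: le_measure; rewrite ?inE.
  - exact: mW.
  - by apply: mW; exact: open_measurable.
  - move=> w /=; rewrite in_itv/= => /andP[h1 h2]; apply: He => //.
    exact: le_lt_trans h2 yse.
have [sea|ase] := leP (s - e) a.
  apply: lt_le_trans Py _; apply: le_measure; rewrite ?inE; try exact: mW.
  move=> w /=; rewrite !in_itv/= => /andP[h1 ->]; rewrite andbT.
  exact: le_lt_trans sea h1.
have sey : s - e < y.
  have sy : s <= y by apply: ge_inf; [by exists a => z []|by split].
  by lra.
(* Otherwise s - e would be a smaller element of E. *)
have P0 : P (W @^-1` `]a, s - e]) = 0%E.
  apply/eqP; rewrite eq_le measure_ge0 andbT leNgt; apply/negP => P0.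
  have : E (s - e) by split => //; [exact: ltW|lra].
  have lbE : has_lbound E by exists a => z [].
  move=> /(ge_inf lbE); rewrite -/s; lra.
apply: lt_le_trans Py _.
rewrite -[leRHS]add0e -P0.
have -> : W @^-1` `]a, y] = W @^-1` `]a, s - e] `|` W @^-1` `]s - e, y].
  rewrite -preimage_setU -itv_bndbnd_setU//= bnd_simp; exact: ltW.
by apply: measureU2; exact: mW.
Qed.

Lemma right_tail_meets_support (t : R) : (0 < P [set w | (t < W w)%R])%E ->
  exists2 s, t <= s & law_support (distribution P W) s.
Proof.
move=> Pt; have [n Pn] : exists n : nat, (0 < P (W @^-1` `]t, (t + n%:R)%R]))%E.
  apply: contrapT => nE; move: Pt; rewrite ltNge => /negP; apply.
  have N : P.-negligible (\bigcup_n (W @^-1` `]t, (t + n%:R)%R])).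
    apply: negligible_bigcup => n; apply/negligibleP; first exact: mW.
    apply/eqP; rewrite eq_le measure_ge0 andbT leNgt; apply/negP => h.
    by apply: nE; exists n.
  have mt : measurable [set w | t < W w].
    rewrite (_ : [set w | _] = W @^-1` `]t, +oo[); first exact: mW.
    by apply/seteqP; split => w /=; rewrite in_itv/= andbT.
  rewrite (_ : P _ = 0%E)//; apply/negligibleP => //; apply: negligibleS N => w /= tw.
  exists (Num.truncn `|W w - t|).+1 => //=; rewrite in_itv/= tw/= -lerBlDl.
  by rewrite (le_trans (ler_norm _))// ltW// truncnS_gt.
have [s [ts _ Ss]] := interval_meets_support Pn.
by exists s.
Qed.

Lemma left_tail_meets_support (t : R) : (0 < P [set w | (W w <= t)%R])%E ->
  exists2 s, s <= t & law_support (distribution P W) s.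
Proof.
move=> Pt; have [n Pn] : exists n : nat, (0 < P (W @^-1` `](t - n%:R)%R, t]))%E.
  apply: contrapT => nE; move: Pt; rewrite ltNge => /negP; apply.
  have N : P.-negligible (\bigcup_n (W @^-1` `](t - n%:R)%R, t])).
    apply: negligible_bigcup => n; apply/negligibleP; first exact: mW.
    apply/eqP; rewrite eq_le measure_ge0 andbT leNgt; apply/negP => h.
    by apply: nE; exists n.
  have mt : measurable [set w | W w <= t].
    rewrite (_ : [set w | _] = W @^-1` `]-oo, t]); first exact: mW.
    by apply/seteqP; split => w /=; rewrite in_itv/=.
  rewrite (_ : P _ = 0%E)//; apply/negligibleP => //; apply: negligibleS N => w /= tw.
  exists (Num.truncn `|t - W w|).+1 => //=; rewrite in_itv/= tw/= andbT.
  rewrite ltrBlDr -ltrBlDl.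
  by rewrite (le_lt_trans (ler_norm _))// truncnS_gt.
have [s [_ st Ss]] := interval_meets_support Pn.
by exists s.
Qed.

End support_of_random_variable.

Section zero_bias_support.
Context d (T : measurableType d) (R : realType) (P : probability T R).
Variables (W : {RV P >-> R}) (v : R).
Hypothesis W2 : (W : T -> R) \in Lfun P 2%:E.
Hypothesis EW : ('E_P[W] = 0)%E.
Hypothesis v0 : 0 < v.
Hypothesis VW : ('V_P[W] = v%:E)%E.
Let p := zero_bias_density P W.
Let mp : measurable_fun [set: R] p := measurable_zero_bias_density W2 EW v0 VW.
Let p0 : forall x, 0 <= p x := zero_bias_density_ge0 W2 EW v0 VW.
Context d' (T' : measurableType d') (Q : probability T' R) (Ws : {RV Q >-> R}).
Hypothesis Wsp : has_density (distribution Q Ws) p.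

Let S := law_support (distribution Q Ws).
Let SW := law_support (distribution P W).

Let nuE (A : set R) : measurable A ->
  distribution Q Ws A = (\int[lebesgue_measure]_(x in A) (p x)%:E)%E.
Proof. by case: Wsp => _ _; exact. Qed.

(** A point is in the support of Ws as soon as p is positive on a
    nondegenerate interval in each of its neighbourhoods. *)
Let mem_S x : (forall e, 0 < e -> exists a b : R,
    [/\ a < b, x - e <= a, b <= x + e & forall t, a < t -> t < b -> 0 < p t]) ->
  S x.
Proof.
move=> H U oU Ux; have [e e0 He] := open_ballR oU Ux.
have [a [b [ab xa bx pab]]] := H e e0.
have abU : `]a, b[ `<=` U.
  move=> t /=; rewrite in_itv/= => /andP[at_ tb]; apply: He.
    exact: le_lt_trans xa at_.
  exact: lt_le_trans tb bx.
have mab : measurable (`]a, b[ : set R) by exact: measurable_itv.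
apply: (@lt_le_trans _ _ (distribution Q Ws `]a, b[)); last first.
  apply: (@le_measure _ _ _ Q); rewrite ?inE; [| |exact: preimage_subset].
  - exact: (measurable_funPTI Ws mab).
  - exact: (measurable_funPTI Ws (open_measurable oU)).
rewrite lt0e measure_ge0 andbT; apply/eqP => nu0.
have mpab : measurable_fun `]a, b[ (EFin \o p).
  by apply/measurable_EFinP; exact: measurable_funTS.
have := (ae_eq_integral_abs lebesgue_measure mab mpab).1.
have -> : (\int[lebesgue_measure]_(x in `]a, b[) `|(EFin \o p) x| = 0)%E.
  rewrite -[RHS]nu0 nuE//; apply: eq_integral => t _ /=.
  by rewrite ger0_norm// p0.
move=> /(_ erefl) ae0.
have : (@lebesgue_measure R).-negligible `]a, b[.
  apply: negligibleS ae0 => t /= tab /(_ tab)[] pt0.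
  by move: tab; rewrite in_itv/= => /andP[/pab h /h]; rewrite pt0 ltxx.
move/(negligibleP lebesgue_measure mab) => mu0.
have := lebesgue_measure_itv `]a, b[; rewrite [LHS]mu0/= lte_fin ab -EFinD => -[].
move/esym.
by move/eqP; rewrite subr_eq0 gt_eqF.
Qed.

Let S_near x e : S x -> 0 < e -> exists t, [/\ x - e < t, t < x + e & 0 < p t].
Proof.
move=> Sx e0; apply: contrapT => nE.
have Ux : `]x - e, x + e[%classic x by rewrite /= in_itv/=; apply/andP; split; lra.
have := Sx _ (@itv_open _ R (x - e) (x + e)) Ux.
rewrite nuE; last exact: measurable_itv.
rewrite integral0_eq ?ltxx// => t /=; rewrite in_itv/= => /andP[t1 t2].
congr EFin; apply/eqP; rewrite eq_le p0 andbT leNgt; apply/negP => pt.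
by apply: nE; exists t.
Qed.

Let S_interval x y z : S x -> S y -> x <= z -> z <= y -> S z.
Proof.
move=> Sx Sy; rewrite le_eqVlt => /predU1P[<-//|xz].
rewrite le_eqVlt => /predU1P[->//|zy].
have xz0 : 0 < z - x by rewrite subr_gt0.
have yz0 : 0 < y - z by rewrite subr_gt0.
have [a [xa ax pa]] := S_near Sx xz0.
have [b [yb by_ pb]] := S_near Sy yz0.
have az : a < z by lra.
have zb : z < b by lra.
apply: mem_S => e e0; exists (Num.max a (z - e)), (Num.min b (z + e)); split.
- by rewrite gt_max !lt_min; apply/andP; split; apply/andP; split; lra.
- by rewrite le_max lexx orbT.
- by rewrite ge_min lexx orbT.
- move=> t; rewrite gt_max lt_min => /andP[at_ _] /andP[tb _].
  exact: (zero_bias_density_gt0_interval W2 EW v0 VW pa pb (ltW at_) (ltW tb)).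
Qed.

(** Otherwise p would vanish almost everywhere, whereas its integral is 1. *)
Let p_gt0_nonzero : exists2 t, t != 0 & 0 < p t.
Proof.
apply: contrapT => nE.
have : (\int[lebesgue_measure]_x (p x)%:E = 1)%E.
  by rewrite -nuE//; exact: probability_setT.
rewrite (ae_eq_integral (cst 0%E)) //.
- by rewrite integral0 => -[/eqP]; rewrite eq_sym oner_eq0.
- exact/measurable_EFinP.
- exists [set 0]; split => //; first exact: lebesgue_measure_set1.
  move=> t /= nt; apply: contrapT => t0; apply: nt => _; congr EFin.
  apply/eqP; rewrite eq_le p0 andbT leNgt; apply/negP => pt.
  by apply: nE; exists t => //; apply/eqP.
Qed.

(** A point x > 0 of the support of W is approached from the left by points t
    with P(W > t) > 0, where p is positive, and symmetrically for x < 0.  At 0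
    there may be no mass of W nearby, but p is positive between 0 and any
    point where it is positive. *)
Let SW_sub_S : SW `<=` S.
Proof.
move=> x SWx.
have [x0|x0|x0] := ltgtP x 0.
- apply: mem_S => e e0; exists x, (Num.min 0 (x + e)); split.
  + by rewrite lt_min x0/=; lra.
  + lra.
  + by rewrite ge_min lexx orbT.
  + move=> t xt; rewrite lt_min => /andP[t0 _].
    apply: (zero_bias_density_gt0_left W2 EW v0 VW t0).
    have := SWx _ (@lray_open _ R t) xt.
    move=> /lt_le_trans; apply; apply: (@le_measure _ _ _ P); rewrite ?inE.
    * exact: measurable_funPTI.
    * rewrite (_ : [set w | _] = W @^-1` `]-oo, t]); first exact: measurable_funPTI.
      by apply/seteqP; split => w /=; rewrite in_itv/=.
    * by move=> w /=; rewrite in_itv/=; exact: ltW.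
- apply: mem_S => e e0; exists (Num.max 0 (x - e)), x; split.
  + by rewrite gt_max x0/=; lra.
  + by rewrite le_max lexx orbT.
  + lra.
  + move=> t; rewrite gt_max => /andP[t0 _] tx.
    apply: (zero_bias_density_gt0_right W2 EW v0 VW (ltW t0)).
    have xt : `]t, +oo[%classic x by rewrite /= in_itv/= andbT.
    have := SWx _ (@rray_open _ R t) xt.
    move=> /lt_le_trans; apply; apply: (@le_measure _ _ _ P); rewrite ?inE.
    * exact: measurable_funPTI.
    * rewrite (_ : [set w | _] = W @^-1` `]t, +oo[); first exact: measurable_funPTI.
      by apply/seteqP; split => w /=; rewrite in_itv/= andbT.
    * by move=> w /=; rewrite in_itv/= andbT.
- rewrite x0; have [s s0 ps] := p_gt0_nonzero.
  move: s0; rewrite neq_lt => /orP[s0|s0]; apply: mem_S => e e0.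
  + exists (Num.max s (- e)), 0; split.
    * by rewrite gt_max s0/= oppr_lt0.
    * by rewrite sub0r le_max lexx orbT.
    * by rewrite add0r ltW.
    * move=> t; rewrite gt_max => /andP[st _] t0.
      exact: lt_le_trans ps (zero_bias_density_nondec W2 EW v0 VW t0 (ltW st)).
  + exists 0, (Num.min s e); split.
    * by rewrite lt_min s0.
    * by rewrite sub0r oppr_le0 ltW.
    * by rewrite add0r ge_min lexx orbT.
    * move=> t t0; rewrite lt_min => /andP[ts _].
      exact: lt_le_trans ps (zero_bias_density_noninc W2 EW v0 VW (ltW t0) (ltW ts)).
Qed.

(** The support of Ws is closed and convex and contains that of W.  It is the
    smallest such set: where p is positive, W charges both sides, so the point
    lies between two points of the support of W. *)
Lemma zero_biased_support : S = closed_convex_hull SW.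
Proof.
apply/seteqP; split.
  move=> x Sx C [[cC /convex_setR_intervalP iC] SWC].
  apply: contrapT => nCx.
  have := Sx (~` C) (closed_openC cC) nCx.
  rewrite nuE; last by apply: open_measurable; exact: closed_openC.
  rewrite integral0_eq ?ltxx// => t /= nCt.
  congr EFin; apply/eqP; rewrite eq_le p0 andbT leNgt; apply/negP => pt.
  have [Pr Pl] := zero_bias_density_tails W2 EW v0 VW pt.
  have [b tb SWb] := right_tail_meets_support Pr.
  have [a at_ SWa] := left_tail_meets_support Pl.
  by apply: nCt; apply: iC (SWC _ SWa) (SWC _ SWb) at_ tb.
apply: smallest_sub; last exact: SW_sub_S.
by split; [exact: closed_law_support|exact/convex_setR_intervalP/S_interval].
Qed.

End zero_bias_support.

(** * The normal law as the unique fixed point *)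

Section zero_bias_density_of_density.
Context d (T : measurableType d) (R : realType) (P : probability T R).
Variables (W : {RV P >-> R}) (v : R).
Hypothesis W2 : (W : T -> R) \in Lfun P 2%:E.
Hypothesis EW : ('E_P[W] = 0)%E.
Hypothesis v0 : 0 < v.
Hypothesis VW : ('V_P[W] = v%:E)%E.
Variable q : R -> R.
Hypothesis Wq : has_density (distribution P W) q.

Lemma integrable_mean_density :
  (@lebesgue_measure R).-integrable [set: R] (fun x => (x * q x)%:E).
Proof.
have mid : measurable_fun [set: R] (id : R -> R) by [].
by have [] := has_density_expectation Wq mid (L2_integrable W2).
Qed.

Lemma zero_bias_density_tail t :
  ((v * zero_bias_density P W t)%:E =
   \int[lebesgue_measure]_(x in `]t, +oo[) (x * q x)%:E)%E.
Proof.
have iW := L2_integrable W2.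
have EW0 : (\int[P]_w (EFin \o W) w = 0)%E by move: EW; rewrite unlock.
pose h x := x * \1_`]t, +oo[ x.
have mh : measurable_fun [set: R] h.
  by apply: measurable_funM => //; exact: measurable_indic.
have ih : P.-integrable [set: T] (fun w => (h (W w))%:E).
  apply: le_integrable iW => //.
    by apply/measurable_EFinP; exact: measurableT_comp.
  move=> w _ /=; rewrite lee_fin normrM ler_piMr// indicE normr_nat.
  by case: (_ \in _).
rewrite -(zero_bias_kernel_mean W2 EW v0 VW).
transitivity (\int[P]_w (h (W w))%:E)%E.
  have -> : (fun w => (zero_bias_kernel (W w) t)%:E) =
      (fun w => (h (W w))%:E - ((t < 0)%R%:R)%:E * (EFin \o W) w)%E.
    apply/funext => w; rewrite /zero_bias_kernel mulrBr EFinB; congr (_ - _)%E.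
      by rewrite /h indicE mem_setE in_itv/= andbT.
    by rewrite mulrC EFinM.
  rewrite integralB//; last exact: integrableZl.
  by rewrite integralZl// EW0 mule0 sube0.
have [_ ->] := has_density_expectation Wq mh ih.
rewrite [RHS]integral_mkcond; apply: eq_integral => x _.
rewrite patchE /h indicE; case: ifPn => _; first by rewrite mulr1.
by rewrite mulr0 mul0r.
Qed.

End zero_bias_density_of_density.

Section normal_pdf_lemmas.
Context (R : realType) (sigma : R).
Hypothesis s0 : 0 < sigma.
Let phi := normal_pdf 0 sigma.

Lemma is_derive_normal_pdf (x : R) :
  is_derive x 1 phi (- (x / sigma ^+ 2) * phi x).
Proof.
have s20 : sigma ^+ 2 != 0 by rewrite sqrf_eq0 gt_eqF.
have s220 : sigma ^+ 2 *+ 2 != 0 by rewrite mulrn_eq0.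
pose g (y : R) := - (sigma ^+ 2 *+ 2)^-1 * y ^+ 2.
have dg : is_derive x 1 g (- (x / sigma ^+ 2)).
  have := is_deriveZ (- (sigma ^+ 2 *+ 2)^-1) (is_deriveX 2 (is_derive_id x 1)).
  rewrite (_ : _ \*: _ = g); last by apply/funext => y; rewrite /g !fctE.
  suff -> : - (sigma ^+ 2 *+ 2)^-1 *: (2%:R * id x ^+ 1)%:A = - (x / sigma ^+ 2) by [].
  rewrite /GRing.scale/= mulr1 expr1 -mulr_natl; field.
  by rewrite gt_eqF.
have phiE y : phi y = normal_peak sigma * expR (g y).
  rewrite /phi normal_pdfE ?gt_eqF// /normal_fun subr0.
  by congr (_ * expR _); rewrite /g; field; rewrite gt_eqF.
have := is_deriveZ (normal_peak sigma) (@is_derive1_comp _ expR g x _ _ (is_derive_expR _) dg).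
rewrite (_ : _ \*: _ = phi); last by apply/funext => y; rewrite phiE.
suff -> : normal_peak sigma *: (expR (g x) * - (x / sigma ^+ 2)) =
    - (x / sigma ^+ 2) * phi x by [].
by rewrite phiE /GRing.scale/=; ring.
Qed.

Lemma normal_pdf_even x : phi (- x) = phi x.
Proof. by rewrite /phi normal_pdfE ?gt_eqF// /normal_fun !subr0 sqrrN. Qed.

Lemma cvg_normal_pdf_pinfty : phi x @[x --> +oo] --> 0.
Proof.
have H : normal_peak sigma * expR (- x) @[x --> +oo] --> (0 : R).
  by rewrite -[X in _ --> X](mulr0 (normal_peak sigma)); apply: cvgMr; exact: cvgr_expR.
apply: (squeeze_cvgr _ (cvg_cst 0) H).
near=> x; rewrite /phi normal_pdf_ge0 andTb normal_pdfE ?gt_eqF//.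
rewrite ler_wpM2l ?normal_peak_ge0// /normal_fun subr0 ler_expR mulNr lerN2.
have x0 : 0 < x by near: x; exact: nbhs_pinfty_gt.
have xs : sigma ^+ 2 *+ 2 <= x.
  by near: x; apply: nbhs_pinfty_ge; exact: num_real.
rewrite ler_pdivlMr ?mulrn_wgt0 ?exprn_gt0// expr2 ler_pM2l//.
Unshelve. all: by end_near. Qed.

Let f (x : R) := x * phi x.
Let F (x : R) := - sigma ^+ 2 * phi x.

Let dF (x : R) : is_derive x 1 F (f x).
Proof.
have := is_deriveZ (- sigma ^+ 2) (is_derive_normal_pdf x).
suff -> : - sigma ^+ 2 *: (- (x / sigma ^+ 2) * phi x) = f x by [].
by rewrite /GRing.scale/= /f; field; rewrite gt_eqF.
Qed.

Let cphi : continuous phi.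
Proof. by apply: continuous_normal_pdf; rewrite gt_eqF. Qed.

Let cf : continuous f.
Proof. by move=> x; apply: cvgM; [exact: cvg_id|exact: cphi]. Qed.

Let F'E : derive1 F = f.
Proof. by apply/funext => x; rewrite derive1E; have [_ <-] := dF x. Qed.

Let mf (A : set R) : measurable_fun A f.
Proof. by apply: measurable_funTS; exact: continuous_measurable_fun. Qed.

Lemma integral_normal_tail_ge0 t : 0 <= t ->
  (\int[lebesgue_measure]_(x in `]t, +oo[) (x * phi x)%:E =
   (sigma ^+ 2 * phi t)%:E)%E.
Proof.
move=> t0.
rewrite integral_itv_obnd_cbnd; last by apply/measurable_EFinP; exact: mf.
rewrite (@ge0_continuous_FTC2y _ f F t 0).
- by rewrite sub0e -EFinN /F mulNr opprK.
- by move=> x tx; rewrite mulr_ge0 ?normal_pdf_ge0// (le_trans t0).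
- exact: continuous_subspaceT.
- rewrite -[X in _ --> X](mulr0 (- sigma ^+ 2)); apply: cvgMr.
  exact: cvg_normal_pdf_pinfty.
- by move=> x _; have [] := dF x.
- apply: cvg_at_right_filter.
  by apply: cvgM; [exact: cvg_cst|exact: cphi].
- by move=> x _; rewrite F'E.
Qed.

(** For t < 0 the integral over ]t, - t] vanishes since the primitive
    - sigma^2 phi is even, which reduces to the tail from - t. *)
Lemma integral_normal_tail t :
  (\int[lebesgue_measure]_(x in `]t, +oo[) (x * phi x)%:E =
   (sigma ^+ 2 * phi t)%:E)%E.
Proof.
have [/integral_normal_tail_ge0//|t0] := leP 0 t.
have tNt : t <= - t by lra.
have iF : (@lebesgue_measure R).-integrable `[t, - t] (EFin \o derive1 F).
  rewrite F'E; apply: continuous_compact_integrable; first exact: segment_compact.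
  exact: continuous_subspaceT.
have I0 : (\int[lebesgue_measure]_(x in `]t, (- t)%R]) (f x)%:E = 0)%E.
  have := integrable_derive1_FTC2 tNt (fun x => let: DeriveDef h _ := dF x in h) iF.
  rewrite F'E /F normal_pdf_even subrr /Rintegral.
  rewrite integral_itv_obnd_cbnd; last by apply/measurable_EFinP; exact: mf.
  move=> H; rewrite -[LHS]fineK ?H//.
  by apply: integrable_fin_num => //; rewrite -F'E.
have Nt0 : 0 <= - t by lra.
rewrite (@itv_bndbnd_setU _ _ _ (BRight (- t))) ?bnd_simp//.
rewrite integral_setU//=.
- by rewrite I0 add0e integral_normal_tail_ge0// normal_pdf_even.
- by apply/measurable_EFinP; exact: mf.
- apply/disj_setPS => y [/=]; rewrite !in_itv/= andbT => /andP[_ yx].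
  by rewrite ltNge yx.
Qed.

End normal_pdf_lemmas.

Lemma continuous_integral_Ny (R : realType) (g : R -> R) :
  (@lebesgue_measure R).-integrable [set: R] (EFin \o g) ->
  continuous (fun t => (\int[lebesgue_measure]_(x in `]-oo, t]) g x)%R).
Proof.
move=> ig t; set G := fun t => (\int[lebesgue_measure]_(x in `]-oo, t]) g x)%R.
have igS (A : set R) : measurable A ->
    (@lebesgue_measure R).-integrable A (EFin \o g).
  by move=> mA; apply: integrableS ig.
have Ginc x y : x <= y ->
    `|G y - G x| <= (\int[lebesgue_measure]_(z in `]x, y]) `|g z|)%R.
  move=> xy; rewrite /G Rintegral_itvB ?bnd_simp//; last exact: igS.
  by apply: le_normr_Rintegral => //; exact: igS.
apply/cvgrPdist_lt => e e0.
have [d [d0 Hd]] := integral_normr_continuous ig e0.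
have Gd x y : x < y -> y - x < d -> `|G y - G x| < e.
  move=> xy yxd; apply: le_lt_trans (Ginc _ _ (ltW xy)) _.
  apply: Hd => //.
  by rewrite [ltLHS](lebesgue_measure_itv `]x, y])/= lte_fin xy -EFinD lte_fin.
apply/nbhs_ballP; exists d => // y; rewrite /ball/= => ty.
have [ty'|yt|<-] := ltgtP t y; last by rewrite subrr normr0.
  by rewrite distrC Gd//; rewrite distrC gtr0_norm ?subr_gt0 in ty.
by rewrite Gd//; rewrite gtr0_norm ?subr_gt0 in ty.
Qed.

Section normal_fixed_point.
Context d (T : measurableType d) (R : realType) (P : probability T R).
Variables (W : {RV P >-> R}) (sigma : R).
Hypothesis W2 : (W : T -> R) \in Lfun P 2%:E.
Hypothesis EW : ('E_P[W] = 0)%E.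
Hypothesis s0 : 0 < sigma.
Hypothesis VW : ('V_P[W] = (sigma ^+ 2)%:E)%E.

Let v0 : 0 < sigma ^+ 2. Proof. by rewrite exprn_gt0. Qed.
Let p := zero_bias_density P W.

Lemma zero_bias_density_normal :
  same_law (distribution P W) (normal_prob 0 sigma) -> p = normal_pdf 0 sigma.
Proof.
move=> WN; have Wphi : has_density (distribution P W) (normal_pdf 0 sigma).
  by split; [exact: measurable_normal_pdf|exact: normal_pdf_ge0|exact: WN].
apply/funext => t.
have := zero_bias_density_tail W2 EW v0 VW Wphi t.
rewrite (integral_normal_tail s0) => -[/(mulfI (lt0r_neq0 v0))]; exact.
Qed.

(** When W has density p, sigma^2 p(t) = - int_{x <= t} x p(x) dx.  Thus p is
    continuous, then differentiable with p' = - t p / sigma^2, so p is a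
    multiple of the normal density, and the factor is 1 because both integrate
    to 1. *)
Lemma zero_bias_density_fixed_normal : has_density (distribution P W) p ->
  same_law (distribution P W) (normal_prob 0 sigma).
Proof.
move=> Wp; have ig := integrable_mean_density W2 Wp.
pose g x := x * p x; rewrite -/g in ig.
pose G t := (\int[lebesgue_measure]_(x in `]-oo, t]) g x)%R.
have igS (A : set R) : measurable A ->
    (@lebesgue_measure R).-integrable A (EFin \o g).
  by move=> mA; apply: integrableS ig.
have g0 : (\int[lebesgue_measure]_x (g x)%:E = 0)%E.
  have mid : measurable_fun [set: R] (id : R -> R) by [].
  have [_ <-] := has_density_expectation Wp mid (L2_integrable W2).
  by move: EW; rewrite unlock.
(* The tail integral of g over ]t, +oo[ is - G t since the mean of W is 0. *)
have pG t : p t = - (sigma ^+ 2)^-1 * G t.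
  have := zero_bias_density_tail W2 EW v0 VW Wp t; rewrite -/p => tail.
  have : (\int[lebesgue_measure]_x (g x)%:E =
      (G t)%:E + (sigma ^+ 2 * p t)%:E)%E.
    rewrite tail -[X in (\int[_]_(x in X) _)%E](@set_itvNyy _ R).
    rewrite (@itv_bndbnd_setU _ _ _ (BRight t))//.
    rewrite integral_setU//=.
    - by rewrite /G /Rintegral fineK//; apply: integrable_fin_num => //; exact: igS.
    - apply: (@measurable_funTS _ _ _ _ _ (EFin \o g)); exact: measurable_int ig.
    - apply/disj_setPS => y [/=]; rewrite !in_itv/= andbT => yx.
      by rewrite ltNge yx.
  rewrite g0 -EFinD => -[/esym/eqP]; rewrite addr_eq0 => /eqP ->.
  by field; rewrite gt_eqF.
have cp : continuous p.
  move=> t; rewrite (_ : p = fun t => - (sigma ^+ 2)^-1 * G t); last exact/funext.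
  by apply: cvgM; [exact: cvg_cst|exact: continuous_integral_Ny].
have cg : continuous g by move=> t; apply: cvgM; [exact: cvg_id|exact: cp].
have dp (t : R) : is_derive t 1 p (- (t / sigma ^+ 2) * p t).
  have tt1 : t < t + 1 by rewrite ltrDl.
  have [dG G'] := @continuous_FTC1 R g -oo%O t (t + 1) tt1 (igS _ (measurable_itv _))
    (ltNyr _) (cg t).
  have iG : is_derive t 1 G (g t).
    by split; [exact: dG|rewrite -derive1E].
  have := is_deriveZ (- (sigma ^+ 2)^-1) iG.
  rewrite (_ : _ \*: _ = p); last by apply/funext => y; rewrite pG.
  suff -> : - (sigma ^+ 2)^-1 *: g t = - (t / sigma ^+ 2) * p t by [].
  by rewrite /GRing.scale/= /g; field; rewrite gt_eqF.
have phi0 t : normal_pdf 0 sigma t != 0.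
  have -> : normal_pdf 0 sigma t = normal_peak sigma * normal_fun 0 sigma t.
    by rewrite normal_pdfE ?gt_eqF.
  apply: mulf_neq0.
    by rewrite gt_eqF// normal_peak_gt0// gt_eqF.
  by rewrite gt_eqF// expR_gt0.
(* p and the normal density solve the same linear differential equation. *)
pose h t := p t / normal_pdf 0 sigma t.
have dh (t : R) : is_derive t 1 h 0.
  have dV := is_deriveV (phi0 t) (is_derive_normal_pdf s0 t).
  have := is_deriveM (dp t) dV.
  rewrite (_ : p * _ = h)//.
  suff -> : p t *: (- normal_pdf 0 sigma t ^- 2 *:
      (- (t / sigma ^+ 2) * normal_pdf 0 sigma t)) +
      (normal_pdf 0 sigma t)^-1 *: (- (t / sigma ^+ 2) * p t) = 0 by [].
  rewrite /GRing.scale/=; field.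
  by rewrite phi0 gt_eqF.
have hc t : h t = h 0 by exact: is_derive_0_is_cst.
have pc t : p t = h 0 * normal_pdf 0 sigma t by rewrite -(hc t) divfK.
have h1 : h 0 = 1.
  have [_ _ WpE] := Wp.
  have := WpE setT measurableT; rewrite [LHS]probability_setT.
  under eq_integral do rewrite -/p pc EFinM.
  rewrite integralZl//; last exact: integrable_normal_pdf.
  by rewrite integral_normal_pdf mule1 => -[].
move=> A mA; have [_ _ ->//] := Wp.
by rewrite /normal_prob; apply: eq_integral => x _; rewrite -/p pc h1 mul1r.
Qed.

End normal_fixed_point.

(** * Independent pairs *)

Section independent_pair.
Context d (T : measurableType d) (R : realType) (P : probability T R).
Context d1 d2 (T1 : measurableType d1) (T2 : measurableType d2).
Variables (Y : {RV P >-> T1}) (Z : {RV P >-> T2}).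
Hypothesis YZ : forall A B, measurable A -> measurable B ->
  (P (Y @^-1` A `&` Z @^-1` B) = P (Y @^-1` A) * P (Z @^-1` B))%E.

Let mYZ : measurable_fun [set: T] (fun w => (Y w, Z w)).
Proof. exact: measurable_fun_pair. Qed.

Definition pair_rv : {mfun T >-> (T1 * T2)%type} := mfun_Sub (mem_set mYZ).

Lemma independent_pair_law A : measurable A ->
  distribution P pair_rv A = (distribution P Y \x distribution P Z)%E A.
Proof.
move=> mA; apply/esym.
exact: (product_measure_unique (m' := distribution P pair_rv)).
Qed.

Lemma ge0_independent_expectation (h : T1 * T2 -> \bar R) :
  measurable_fun [set: T1 * T2] h -> (forall z, 0 <= h z)%E ->
  (\int[P]_w h (Y w, Z w) =
   \int[distribution P Y]_y \int[distribution P Z]_z h (y, z))%E.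
Proof.
move=> mh h0; rewrite -(fubini_tonelli1 h)//.
rewrite [RHS](eq_measure_integral (distribution P pair_rv)); last first.
  by move=> A mA _; exact/esym/independent_pair_law.
by rewrite ge0_integral_distribution.
Qed.

Lemma independent_expectation (h : T1 * T2 -> R) :
  measurable_fun [set: T1 * T2] h ->
  P.-integrable [set: T] (fun w => (h (Y w, Z w))%:E) ->
  (\int[P]_w (h (Y w, Z w))%:E =
   \int[distribution P Y]_y \int[distribution P Z]_z (h (y, z))%:E)%E.
Proof.
move=> mh ih.
have mhE : measurable_fun [set: T1 * T2] (EFin \o h) by apply/measurable_EFinP.
have ihp : (distribution P Y \x distribution P Z)%E.-integrable
    [set: T1 * T2] (EFin \o h).
  apply/integrableP; split => //.
  rewrite (eq_measure_integral (distribution P pair_rv)); last first.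
    by move=> A mA _; exact/esym/independent_pair_law.
  rewrite ge0_integral_distribution//; last exact: measurableT_comp.
  by have /integrableP[] := ih.
rewrite (integral12_prod_meas1 ihp).
rewrite [RHS](eq_measure_integral (distribution P pair_rv)); last first.
  by move=> A mA _; exact/esym/independent_pair_law.
exact/esym/(integral_distribution (X := pair_rv) mhE ih).
Qed.

End independent_pair.

Section independent_events_lemmas.
Context d (T : measurableType d) (R : realType) (P : probability T R).

Variables (I : finType) (X : I -> {RV P >-> R}).

Lemma family_generated_byX (D : set I) i (A : set R) : D i -> measurable A ->
  family_generated_by D (fun i => X i : T -> R) (X i @^-1` A).
Proof.
move=> Di mA; apply: sub_gen_smallest; exists i => //.
by exists A => //; rewrite setTI.
Qed.

(** A sum of variables measurable for a sub-sigma-algebra is measurable for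
    it; the sub-sigma-algebra is used as a measurable space of its own. *)
Lemma family_generated_by_sum (G : set (set T)) (J : pred I) (Y : I -> T -> R) :
  (forall i, J i -> forall A, measurable A -> <<s G >> (Y i @^-1` A)) ->
  forall A, measurable A -> <<s G >> ((fun w => \sum_(i | J i) Y i w) @^-1` A).
Proof.
move=> HY A mA.
pose TG := g_sigma_algebraType G.
have mY i : J i -> @measurable_fun _ _ TG _ setT (Y i).
  by move=> Ji _ B mB; rewrite setTI; exact: HY.
have : @measurable_fun _ _ TG _ setT (fun w => \sum_(i | J i) Y i w).
  have -> : (fun w => \sum_(i | J i) Y i w) =
      (fun w => \sum_(i <- index_enum I) (if J i then Y i w else 0)).
    by apply/funext => w; exact: big_mkcond.
  apply: measurable_sum => i; have [Ji|_] := boolP (J i); last exact: measurable_cst.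
  exact: mY.
by move=> /(_ measurableT A mA); rewrite setTI.
Qed.

(** The boxes that constrain every X j with j != i form a pi-system that
    generates the sigma-algebra of these variables.  On them mutual independence
    gives the product formula, and two finite measures that agree on a
    pi-system agree on what it generates. *)
Lemma mutually_independent_rest (i : I) (A B : set T) :
  mutually_independent P (fun i => X i : T -> R) ->
  generated_by (X i) A ->
  family_generated_by [set j | j != i] (fun i => X i : T -> R) B ->
  P (A `&` B) = (P A * P B)%E.
Proof.
move=> indX [A' mA' <-{A}]; rewrite setTI => FB.
pose J := [set j : I | j != i]%SET.
pose box (C : I -> set R) := \bigcap_(j in [set` J]) (X j @^-1` (C j)).
pose G := [set B | exists2 C : I -> set R, (forall j, measurable (C j)) & B = box C].
have mbox C : (forall j, measurable (C j)) -> measurable (box C).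
  move=> mC; apply: fin_bigcap_measurable => //.
  by move=> j _; exact: measurable_funPTI.
have mXA : measurable (X i @^-1` A') by exact: measurable_funPTI.
have GB : <<s G >> B.
  move: B FB; apply: smallest_sub; first exact: smallest_sigma_algebra.
  move=> _ [j /= ji [C mC <-]]; apply: sub_gen_smallest.
  exists (fun k => if k == j then C else setT).
    by move=> k; case: ifPn.
  rewrite setTI; apply/seteqP; split => [w Cw k _|w /(_ j)] /=.
    by case: eqP => // ->.
  by rewrite eqxx; apply; rewrite /= inE.
pose m1 := mrestr P mXA.
have pA0 : 0 <= fine (P (X i @^-1` A')) by rewrite fine_ge0.
pose m2 := mscale (NngNum pA0) P.
have m2E C : m2 C = (P (X i @^-1` A') * P C)%E.
  by rewrite /m2 /mscale/= fineK ?fin_num_measure.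
suff : m1 B = m2 B by rewrite m2E => <-; rewrite /m1 /mrestr setIC.
apply: (@g_sigma_algebra_measure_unique _ _ _ G _ (fun=> setT)) => //.
- by move=> _ [C mC ->]; exact: mbox.
- move=> _; exists (fun=> setT) => //.
  by apply/esym; rewrite -subTset => w _ j _.
- by apply/seteqP; split => // w _; exists 0%N.
- move=> _ _ [C mC ->] [D mD ->]; exists (fun j => C j `&` D j).
    by move=> j; exact: measurableI.
  by rewrite /box -bigcapI.
- move=> _ [C mC ->]; change (m1 (box C) = m2 (box C)).
  rewrite m2E /m1 /mrestr.
  pose D j := if j == i then A' else C j.
  have mD j : measurable (D j) by rewrite /D; case: ifPn.
  have -> : box C `&` (X i @^-1` A') =
      \bigcap_(j in [set` [set: I]%SET]) (X j @^-1` D j).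
    apply/seteqP; split => [w [Cw Aw] j _|w Dw]; rewrite /D/=.
      case: eqP => [->//|/eqP ji]; apply: Cw; by rewrite /= inE.
    split => [j /=|]; last by have := Dw i; rewrite /D/= eqxx inE; exact.
    by rewrite inE => /negbTE ji; have := Dw j; rewrite /D/= ji inE; exact.
  rewrite (indX _ D mD) (indX J C mC) (bigD1 i)/= ?inE// /D eqxx.
  congr (_ * _)%E; apply: eq_big => j; first by rewrite !inE.
  by rewrite inE => /negbTE ->.
- move=> _; change (m1 setT < +oo)%E; rewrite /m1 /mrestr setTI.
  by apply: le_lt_trans (ltry 1); exact: probability_le1.
Qed.

End independent_events_lemmas.

(** * Replacing one summand at a random index *)

Lemma test_translate (R : realType) (f : R -> R) (y : R) : test_function f ->
  test_function (fun x => f (y + x)) /\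
  derive1 (fun x => f (y + x)) = fun x => derive1 f (y + x).
Proof.
move=> [df cf' f'01].
have dt (x : R) : is_derive x 1 (fun x => f (y + x)) (derive1 f (y + x)).
  have dy : is_derive x 1 (fun x => y + x) 1.
    apply: (@is_derive_quadratic _ _ _ _ 0) => h.
    by rewrite mul0r (_ : _ - _ = 0) ?normr0//; ring.
  have dfy : is_derive (y + x) 1 f (derive1 f (y + x)).
    by rewrite derive1E; exact: derivableP.
  by have := is_derive1_comp dfy dy; rewrite mulr1.
have E : derive1 (fun x => f (y + x)) = fun x => derive1 f (y + x).
  by apply/funext => x; rewrite derive1E; have [_ <-] := dt x.
split => //; split; rewrite ?E//.
- move=> x; apply: (continuous_comp (f := fun x => y + x)); last exact: cf'.
  by apply: (@cvgD _ R^o); [exact: cvg_cst|exact: cvg_id].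
Qed.

Lemma test_id (R : realType) :
  test_function (id : R -> R) /\ derive1 (id : R -> R) = fun=> 1.
Proof.
have E : derive1 (id : R -> R) = fun=> 1.
  by apply/funext => x; rewrite derive1E derive_id.
split => //; split; rewrite ?E//.
- by move=> x; exact: cvg_cst.
- by move=> x; rewrite ler01 lexx.
Qed.

Section replace_summand.
Context d (T : measurableType d) (R : realType) (P : probability T R).
Variables (Y X Xs : {RV P >-> R}) (v : R).
Hypothesis Y2 : (Y : T -> R) \in Lfun P 2%:E.
Hypothesis X2 : (X : T -> R) \in Lfun P 2%:E.
Hypothesis YX : forall A B : set R, measurable A -> measurable B ->
  (P (Y @^-1` A `&` X @^-1` B) = P (Y @^-1` A) * P (X @^-1` B))%E.
Variables (f : R -> R) (tf : test_function f).

Lemma integrable_mul_test_sum :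
  P.-integrable [set: T] (fun w => (X w * f (Y w + X w))%:E).
Proof.
have iX := L2_integrable X2.
have iXY := (Lfun1_integrable P _).1 (Lfun2_mul_Lfun1 X2 Y2).
have iXX := Lfun2_integrable_sqr X2.
have := integrableD measurableT (integrableZl measurableT `|f 0| (integrable_abse iX))
  (integrableD measurableT (integrable_abse iXY) (integrable_abse iXX)).
apply: le_integrable => //.
  apply/measurable_EFinP; apply: measurable_funM => //.
  apply: measurableT_comp; first exact: test_measurable.
  exact: measurable_funD.
move=> w _ /=; rewrite lee_fin normrM.
apply: (@le_trans _ _ (`|X w| * (`|f 0| + (`|Y w| + `|X w|)))).
  rewrite ler_wpM2l// (le_trans (test_linear_growth tf _))// lerD2l.
  exact: ler_normD.
rewrite [leRHS]ger0_norm ?addr_ge0 ?mulr_ge0//.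
rewrite !mulrDr normrM (mulrC `|f 0|) normrX expr2.
exact: lexx.
Qed.

Hypothesis v0 : 0 < v.
Hypothesis VX : ('V_P[X] = v%:E)%E.
Hypothesis zb : zero_biased P X P Xs.
Hypothesis YXs : forall A B : set R, measurable A -> measurable B ->
  (P (Y @^-1` A `&` Xs @^-1` B) = P (Y @^-1` A) * P (Xs @^-1` B))%E.

(** Given Y = y, this is the zero bias identity of X for the translate
    f(y + .), which is again a test function; independence of X, respectively
    of Xs, from Y allows integrating over y. *)
Lemma zero_biased_replace :
  (\int[P]_w (X w * f (Y w + X w))%:E =
   v%:E * \int[P]_w (derive1 f (Y w + Xs w))%:E)%E.
Proof.
have mf := test_measurable tf.
pose h (z : R * R) := z.2 * f (z.1 + z.2).
have mh : measurable_fun [set: R * R] h.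
  apply: measurable_funM => //; apply: measurableT_comp => //.
  exact: measurable_funD.
rewrite (independent_expectation YX mh integrable_mul_test_sum).
pose h' (z : R * R) : \bar R := (derive1 f (z.1 + z.2))%:E.
have mh' : measurable_fun [set: R * R] h'.
  apply/measurable_EFinP; apply: measurableT_comp.
    exact: test_measurable_derive1.
  exact: measurable_funD.
have h'0 z : (0 <= h' z)%E by rewrite lee_fin test_derive1_ge0.
rewrite (ge0_independent_expectation YXs mh' h'0).
rewrite -ge0_integralZl//; last 3 first.
- exact: (measurable_fun_fubini_tonelli_F (m2 := distribution P Xs) h' mh' h'0).
- by move=> y _; apply: integral_ge0 => z _; exact: h'0.
- by rewrite lee_fin ltW.
apply: eq_integral => y _.
have [ty f'yE] := test_translate y tf.
rewrite (ge0_integral_distribution Xs (measurableT_comp mh' (measurable_pair1 y))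
  (fun z => h'0 (y, z))).
have ih : P.-integrable [set: T] (fun w => (X w * f (y + X w))%:E).
  exact: integrable_mul_linear_growth X2 (test_measurable ty) (test_linear_growth ty).
have mhy : measurable_fun [set: R] (fun z => (h (y, z))%:E).
  by apply/measurable_EFinP; exact: measurableT_comp mh (measurable_pair1 y).
rewrite (integral_distribution mhy ih).
have := zero_biased_test X2 VX ty zb.
by rewrite f'yE.
Qed.

End replace_summand.

Section random_index.
Context d (T : measurableType d) (R : realType) (P : probability T R).
Context (K : finType) (X Xs : K -> {RV P >-> R}) (sigma : K -> R) (I : T -> K).
Let W := fun w => \sum_i X i w.
Let sigma2 := \sum_i sigma i ^+ 2.
Hypothesis indX : mutually_independent P (fun i => X i : T -> R).
Hypothesis X2 : forall i, (X i : T -> R) \in Lfun P 2%:E.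
Hypothesis EX : (forall i, 'E_P[X i] = 0)%E.
Hypothesis EX2 : forall i, ('E_P[fun w => (X i w ^+ 2)%R] = (sigma i ^+ 2)%:E)%E.
Hypothesis v0 : 0 < sigma2.
Hypothesis zb : forall i, 0 < sigma i ^+ 2 -> zero_biased P (X i) P (Xs i).
Hypothesis indXs : forall i, 0 < sigma i ^+ 2 ->
  independent_events P (generated_by (Xs i))
    (family_generated_by [set j | j != i] (fun i => X i : T -> R)).
Hypothesis mI : forall i, measurable (I @^-1` [set i]).
Hypothesis indI : independent_events P [set I @^-1` S | S in [set: set K]]
  <<s family_generated_by [set: K] (fun i => X i : T -> R) `|`
      family_generated_by [set j | 0 < sigma j ^+ 2] (fun i => Xs i : T -> R) >>.
Hypothesis PI : forall i, P (I @^-1` [set i]) = (sigma i ^+ 2 / sigma2)%:E.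

Let rest i w := \sum_(j | j != i) X j w.

Let mrest i : measurable_fun [set: T] (rest i).
Proof.
rewrite /rest; under eq_fun do rewrite big_mkcond/=.
apply: measurable_sum => j; have [_|_] := boolP (j != i) => //.
Qed.

Let restX i : {RV P >-> R} := mfun_Sub (mem_set (mrest i)).

Let sumE i w : W w = rest i w + X i w.
Proof. by rewrite /W (bigD1 i)//= addrC. Qed.

Let Lfun_sum (J : pred K) : (fun w => \sum_(j | J j) X j w) \in Lfun P 2%:E.
Proof.
rewrite (_ : (fun w => _) = \sum_(j | J j) (X j : T -> R)); last first.
  by apply/funext => w; rewrite fct_sumE.
have p1 : (1 <= 2%:E :> \bar R)%E by rewrite lee_fin ler1n.
have [L0 LD] := @Lfun_addr_closed _ T R P 2%:E p1.
by apply: (big_ind (fun g : T -> R => g \in Lfun P 2%:E)).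
Qed.

Let W2 : W \in Lfun P 2%:E. Proof. exact: Lfun_sum. Qed.
Let rest2 i : (restX i : T -> R) \in Lfun P 2%:E. Proof. exact: Lfun_sum. Qed.

Let mem_rest i (A : set R) : measurable A ->
  family_generated_by [set j | j != i] (fun i => X i : T -> R) (rest i @^-1` A).
Proof.
apply: family_generated_by_sum => j ji B mB.
by apply: sub_gen_smallest; exists j => //; exists B => //; rewrite setTI.
Qed.

Let ind_rest_X i (A B : set R) : measurable A -> measurable B ->
  (P (restX i @^-1` A `&` X i @^-1` B) =
   P (restX i @^-1` A) * P (X i @^-1` B))%E.
Proof.
move=> mA mB; rewrite setIC muleC; apply: (mutually_independent_rest indX).
  by exists B => //; rewrite setTI.
exact: mem_rest.
Qed.

Let ind_rest_Xs i (A B : set R) : 0 < sigma i ^+ 2 -> measurable A -> measurable B ->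
  (P (restX i @^-1` A `&` Xs i @^-1` B) =
   P (restX i @^-1` A) * P (Xs i @^-1` B))%E.
Proof.
move=> si mA mB; rewrite setIC muleC; apply: (indXs si).
  by exists B => //; rewrite setTI.
exact: mem_rest.
Qed.

Let VX i : ('V_P[X i] = (sigma i ^+ 2)%:E)%E.
Proof.
by rewrite varianceE// EX expe2 mule0 sube0 -EX2; congr expectation.
Qed.

(** For sigma i = 0 both sides vanish, because X i = 0 almost surely;
    otherwise X i is replaced by Xs i against the remaining sum. *)
Lemma expectation_summand_test i f : test_function f ->
  (\int[P]_w (X i w * f (W w))%:E =
   (sigma i ^+ 2)%:E * \int[P]_w (derive1 f (restX i w + Xs i w))%:E)%E.
Proof.
move=> tf.
have := sqr_ge0 (sigma i); rewrite le_eqVlt => /predU1P[si|si]; last first.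
  rewrite -(zero_biased_replace (rest2 i) (X2 i) (ind_rest_X i) tf si (VX i)
    (zb si) (fun A B => @ind_rest_Xs i A B si)).
  by apply: eq_integral => w _; rewrite (sumE i).
rewrite -si mul0e.
have mXX : measurable_fun [set: T] (fun w => (X i w ^+ 2)%:E).
  by apply/measurable_EFinP; exact: measurable_funX.
have := (ae_eq_integral_abs P measurableT mXX).1.
have -> : (\int[P]_w `|(X i w ^+ 2)%:E| = 0)%E.
  have E2 := EX2 i; rewrite unlock -si in E2.
  apply: etrans E2; apply: eq_integral => w _.
  by rewrite gee0_abs// lee_fin sqr_ge0.
move=> /(_ erefl) X0.
rewrite (ae_eq_integral (cst 0%E))//.
- by rewrite integral0.
- apply/measurable_EFinP; apply: measurable_funM => //.
  apply: measurableT_comp; first exact: test_measurable.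
  by have := sub_Lfun_mfun W2; rewrite inE.
- apply: filterS X0 => w /(_ Logic.I) -[/eqP]; rewrite sqrf_eq0 => /eqP -> _.
  by rewrite mul0r.
Qed.

Lemma expectation_sum_test f : test_function f ->
  (\int[P]_w (W w * f (W w))%:E =
   \sum_i (sigma i ^+ 2)%:E * \int[P]_w (derive1 f (restX i w + Xs i w))%:E)%E.
Proof.
move=> tf; transitivity (\int[P]_w \sum_i (X i w * f (W w))%:E)%E.
  by apply: eq_integral => w _; rewrite {1}/W mulr_suml sumEFin.
rewrite integral_sum//; last first.
  move=> i; have := integrable_mul_test_sum (rest2 i) (X2 i) tf.
  by apply: eq_integrable => // w _; rewrite (sumE i).
by apply: eq_bigr => i _; exact: expectation_summand_test.
Qed.

(** The identity for the test function f(x) = x, whose derivative is 1. *)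
Lemma expectation_sum_sqr : ('E_P[fun w => (W w ^+ 2)%R] = sigma2%:E)%E.
Proof.
have [tid idE] := test_id R.
have H := expectation_sum_test tid; rewrite idE in H.
rewrite unlock; transitivity (\int[P]_w (W w * W w)%:E)%E.
  by apply: eq_integral => w _; rewrite expr2.
apply: etrans H _; rewrite /sigma2 -sumEFin; apply: eq_bigr => i _.
by rewrite integral_cst//= probability_setT !mule1.
Qed.

Let EW : ('E_P[W] = 0)%E.
Proof.
rewrite unlock.
transitivity (\int[P]_w \sum_i (X i w)%:E)%E.
  by apply: eq_integral => w _; rewrite sumEFin.
rewrite integral_sum//; last by move=> i; exact: L2_integrable (X2 i).
by apply: big1 => i _; have := EX i; rewrite unlock.
Qed.

Let VW : ('V_P[W] = sigma2%:E)%E.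
Proof.
by rewrite varianceE// EW expe2 mule0 sube0 -expectation_sum_sqr; congr expectation.
Qed.

Let V w := \sum_(j | j != I w) X j w + Xs (I w) w.
Let Vi i w := restX i w + Xs i w.

Let mVi i : measurable_fun [set: T] (Vi i).
Proof. exact: measurable_funD. Qed.

(** The index enters through these indicators, which turn a quantity
    evaluated at the random index into a finite sum. *)
Let Y i w : R := (I w == i)%:R.

Let YE i : Y i = \1_(I @^-1` [set i]).
Proof.
apply/funext => w; rewrite /Y indicE; congr (nat_of_bool _)%:R.
by apply/eqP/idP => [e|/set_mem]; [apply/mem_set|].
Qed.

Let mY i : measurable_fun [set: T] (Y i).
Proof. by rewrite YE; exact: measurable_indic. Qed.

Let ind_Y_V i (A B : set R) : 0 < sigma i ^+ 2 -> measurable A -> measurable B ->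
  (P (Y i @^-1` A `&` Vi i @^-1` B) = P (Y i @^-1` A) * P (Vi i @^-1` B))%E.
Proof.
move=> si mA mB; apply: indI; first by exists [set k | A (k == i)%:R].
set G := (X in <<s X >>).
(* The replaced sum is measurable for G, the sigma-algebra of all the X j and
   Xs j, of which the index is independent. *)
pose TG := g_sigma_algebraType G.
have m1 : @measurable_fun _ _ TG _ setT (restX i).
  move=> _ C mC; rewrite setTI.
  have : <<s G >> (rest i @^-1` C); last exact.
  apply: family_generated_by_sum mC => j ji D mD.
  by apply: sub_gen_smallest; left; exact: (@family_generated_byX _ _ _ P _ X setT j).
have m2 : @measurable_fun _ _ TG _ setT (Xs i).
  move=> _ C mC; rewrite setTI.
  by apply: sub_gen_smallest; right; exact: (@family_generated_byX _ _ _ P _ Xs _ i).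
by have := measurable_funD m1 m2 measurableT mB; rewrite setTI.
Qed.

Let sum_index (F : K -> T -> R) w : \sum_i Y i w * F i w = F (I w) w.
Proof.
rewrite (bigD1 (I w))//= /Y eqxx mul1r big1 ?addr0// => i iI.
by rewrite eq_sym (negbTE iI) mul0r.
Qed.

Lemma measurable_random_replacement : measurable_fun [set: T] V.
Proof.
rewrite (_ : V = fun w => \sum_i Y i w * Vi i w).
  by apply: measurable_sum => i; exact: measurable_funM.
by apply/funext => w; rewrite sum_index.
Qed.

(** Independence of the index and the variable whose summand i has been
    replaced.  It is available for sigma i > 0 only, but otherwise the index
    almost surely differs from i. *)
Lemma expectation_index_test i f : test_function f ->
  (\int[P]_w (Y i w * derive1 f (Vi i w))%:E =
   (sigma i ^+ 2 / sigma2)%:E * \int[P]_w (derive1 f (Vi i w))%:E)%E.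
Proof.
move=> tf.
have EY : (\int[P]_w (Y i w)%:E = (sigma i ^+ 2 / sigma2)%:E)%E.
  by rewrite -PI YE integral_indic// setIT.
have mf' := test_measurable_derive1 tf.
have mf'V : measurable_fun [set: T] (fun w => derive1 f (Vi i w)).
  exact: measurableT_comp.
have := sqr_ge0 (sigma i); rewrite le_eqVlt => /predU1P[si|si].
  (* f' <= 1, so the left side is at most P(I = i) = sigma i ^+ 2 / sigma2 = 0. *)
  rewrite -si mul0r mul0e; apply/eqP; rewrite eq_le; apply/andP; split; last first.
    by apply: integral_ge0 => w _; rewrite lee_fin mulr_ge0// test_derive1_ge0.
  rewrite -si mul0r in EY; rewrite -[leRHS]EY; apply: ge0_le_integral => //=.
  - by move=> w _; rewrite lee_fin mulr_ge0// test_derive1_ge0.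
  - by apply/measurable_EFinP; exact: measurable_funM.
  - exact/measurable_EFinP.
  - move=> w _; rewrite lee_fin ler_piMr//.
    by have [_ _ /(_ (Vi i w))/andP[]] := tf.
pose Y' : {RV P >-> R} := mfun_Sub (mem_set (mY i)).
pose Z' : {RV P >-> R} := mfun_Sub (mem_set (mVi i)).
pose h (z : R * R) : \bar R := (`|z.1| * derive1 f z.2)%:E.
have mh : measurable_fun [set: R * R] h.
  apply/measurable_EFinP; apply: measurable_funM; last exact: measurableT_comp.
  exact: measurableT_comp.
have h0 z : (0 <= h z)%E by rewrite lee_fin mulr_ge0// test_derive1_ge0.
have mf'E : measurable_fun [set: R] (EFin \o derive1 f) by apply/measurable_EFinP.
have f'0 z : (0 <= (EFin \o derive1 f) z)%E by rewrite lee_fin test_derive1_ge0.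
have := ge0_independent_expectation (Y := Y') (Z := Z')
  (fun A B => @ind_Y_V i A B si) mh h0.
have -> : (\int[P]_w h (Y' w, Z' w) =
    \int[P]_w (Y i w * derive1 f (Vi i w))%:E)%E.
  by apply: eq_integral => w _; rewrite /h/= ger0_norm.
move=> ->.
have inner y : (\int[distribution P Z']_z h (y, z) =
    `|y|%:E * \int[P]_w (derive1 f (Vi i w))%:E)%E.
  rewrite -(ge0_integral_distribution Z' mf'E f'0).
  by rewrite -ge0_integralZl// ?lee_fin//; apply: eq_integral.
under eq_integral do rewrite inner.
rewrite ge0_integralZr//; last 2 first.
- by apply/measurable_EFinP; exact: normr_measurable.
- by apply: integral_ge0 => w _; rewrite lee_fin test_derive1_ge0.
congr (_ * _)%E; rewrite -EY.
rewrite (ge0_integral_distribution Y' (f := fun y => `|y|%:E))//; last first.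
  by apply/measurable_EFinP; exact: normr_measurable.
by apply: eq_integral => w _ /=; rewrite ger0_norm.
Qed.

Lemma random_replacement_zero_biased : zero_biased P W P V.
Proof.
have mW : measurable_fun [set: T] W by have := sub_Lfun_mfun W2; rewrite inE.
pose W' : {RV P >-> R} := mfun_Sub (mem_set mW).
pose V' : {RV P >-> R} := mfun_Sub (mem_set measurable_random_replacement).
apply: (has_density_zero_biased (W := W') (Ws := V') W2 EW v0 VW).
apply: (test_has_density (W := W') (Ws := V') W2 EW v0 VW) => f tf.
apply: etrans (expectation_sum_test tf) _.
have -> : (\int[P]_w (derive1 f (V' w))%:E =
    \sum_i \int[P]_w (Y i w * derive1 f (Vi i w))%:E)%E.
  rewrite -ge0_integral_sum//.
  - apply: eq_integral => w _; rewrite sumEFin; congr EFin.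
    exact/esym/(sum_index (fun i w => derive1 f (Vi i w))).
  - move=> i; apply/measurable_EFinP; apply: measurable_funM => //.
    exact: measurableT_comp (test_measurable_derive1 tf) (mVi i).
  - by move=> i w _; rewrite lee_fin mulr_ge0// test_derive1_ge0.
rewrite ge0_sume_distrr; last first.
  move=> i _; apply: integral_ge0 => w _.
  by rewrite lee_fin mulr_ge0// test_derive1_ge0.
apply: eq_bigr => i _; rewrite expectation_index_test// muleA -EFinM.
by rewrite mulrC divfK// gt_eqF.
Qed.

End random_index.

(** * The square bias construction *)

Lemma integral_affine3 d (T : measurableType d) (R : realType)
    (P : probability T R) (A B C : T -> R) (al be ga k a b c : R) :
  P.-integrable [set: T] (EFin \o A) -> P.-integrable [set: T] (EFin \o B) ->
  P.-integrable [set: T] (EFin \o C) ->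
  (\int[P]_w (A w)%:E = al%:E)%E -> (\int[P]_w (B w)%:E = be%:E)%E ->
  (\int[P]_w (C w)%:E = ga%:E)%E ->
  (\int[P]_w (k + a * A w + b * B w + c * C w)%:E =
   (k + a * al + b * be + c * ga)%:E)%E.
Proof.
move=> iA iB iC EA EB EC.
have ik : P.-integrable [set: T] (cst k%:E) by exact: finite_measure_integrable_cst.
have iaA : P.-integrable [set: T] (fun w => a%:E * (EFin \o A) w)%E by exact: integrableZl.
have ibB : P.-integrable [set: T] (fun w => b%:E * (EFin \o B) w)%E by exact: integrableZl.
have icC : P.-integrable [set: T] (fun w => c%:E * (EFin \o C) w)%E by exact: integrableZl.
under eq_integral do rewrite !EFinD !EFinM.
rewrite integralD//; last by do 2 apply: integrableD => //.
rewrite integralD//; last by apply: integrableD.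
rewrite integralD// integral_cst//= probability_setT mule1.
by rewrite !integralZl// EA EB EC.
Qed.

Section square_bias.
Context d d' (T : measurableType d) (T' : measurableType d') (R : realType).
Variables (P : probability T R) (Q : probability T' R) (X : {RV P >-> R}).
Variables (sigma : R) (Xh : {RV Q >-> (R * R)%type}) (U : {RV Q >-> R}).
Hypothesis X2 : (X : T -> R) \in Lfun P 2%:E.
Hypothesis EX : ('E_P[X] = 0)%E.
Hypothesis s0 : 0 < sigma.
Hypothesis XhE : forall A, measurable A ->
  distribution Q Xh A =
  (\int[distribution P X \x distribution P X]_(x in A)
     ((x.1 - x.2) ^+ 2 / (2 * sigma ^+ 2))%:E)%E.
Hypothesis Uunif : same_law (distribution Q U) (uniform_prob (@ltr01 R)).
Hypothesis UXh : independent_events Q (generated_by U) (generated_by Xh).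

Let v0 : 0 < sigma ^+ 2. Proof. by rewrite exprn_gt0. Qed.

Let comb (z : R * R) (u : R) := u * z.1 + (1 - u) * z.2.

Let measurable_comb : measurable_fun [set: (R * R) * R] (fun x => comb x.1 x.2).
Proof.
apply: measurable_funD; apply: measurable_funM => //.
- exact: measurableT_comp.
- exact: measurable_funB.
- exact: measurableT_comp.
Qed.

Variables (f : R -> R) (tf : test_function f).

(** The derivative of u |-> f(u x + (1 - u) y) is (x - y) f'(u x + (1 - u) y),
    to be integrated over [0, 1]. *)
Lemma integral_uniform_segment (z : R * R) :
  (((z.1 - z.2) ^+ 2)%:E * \int[Q]_w (derive1 f (comb z (U w)))%:E =
   ((z.1 - z.2) * (f z.1 - f z.2))%:E)%E.
Proof.
have [df cf' f'01] := tf.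
have Udens : has_density (distribution Q U) (uniform_pdf 0 1).
  split; [exact: measurable_uniform_pdf| |exact: Uunif].
  by move=> x; exact: uniform_pdf_ge0.
pose g u := derive1 f (comb z u).
have ccomb : continuous (comb z).
  move=> u; apply: cvgD; apply: cvgM; [exact: cvg_id|exact: cvg_cst| |exact: cvg_cst].
  by apply: cvgB; [exact: cvg_cst|exact: cvg_id].
have cg : continuous g.
  by move=> u; apply: (continuous_comp (ccomb u)); exact: cf'.
have mg : measurable_fun [set: R] (EFin \o g).
  by apply/measurable_EFinP; exact: continuous_measurable_fun.
have g0 u : (0 <= (EFin \o g) u)%E by rewrite lee_fin test_derive1_ge0.
rewrite (ge0_has_density_expectation Udens mg g0).
have -> : (\int[lebesgue_measure]_x ((EFin \o g) x * (uniform_pdf 0 1 x)%:E) =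
    \int[lebesgue_measure]_(x in `[0%R, 1%R]) (g x)%:E)%E.
  rewrite [RHS]integral_mkcond; apply: eq_integral => x _.
  rewrite patchE /uniform_pdf mem_setE in_itv/=.
  by case: ifPn => _; rewrite ?subr0 ?invr1 ?mule1// mule0.
pose F u := f (comb z u).
have dF (u : R) : is_derive u 1 F ((z.1 - z.2) * g u).
  have dc : is_derive u 1 (comb z) (z.1 - z.2).
    apply: (@is_derive_quadratic _ _ _ _ 0) => h.
    by rewrite mul0r /comb (_ : _ - _ = 0) ?normr0//; ring.
  have dfc : is_derive (comb z u) 1 f (g u).
    by rewrite /g derive1E; exact: derivableP.
  by have := is_derive1_comp dfc dc; rewrite mulrC.
have F'E : derive1 F = fun u => (z.1 - z.2) * g u.
  by apply/funext => u; rewrite derive1E; have [_ <-] := dF u.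
have cF' : continuous (fun u => (z.1 - z.2) * g u).
  by move=> u; apply: cvgM; [exact: cvg_cst|exact: cg].
have ig : (@lebesgue_measure R).-integrable `[0, 1] (EFin \o g).
  apply: continuous_compact_integrable; first exact: segment_compact.
  exact: continuous_subspaceT.
have iF : (@lebesgue_measure R).-integrable `[0, 1] (EFin \o derive1 F).
  rewrite F'E; apply: continuous_compact_integrable; first exact: segment_compact.
  exact: continuous_subspaceT.
have := integrable_derive1_FTC2 ler01 (fun u => let: DeriveDef h _ := dF u in h) iF.
rewrite F'E /F /comb !mul1r !mul0r subrr subr0 mul0r addr0 add0r mul1r.
rewrite RintegralZl// => <-.
rewrite /Rintegral mulrA -expr2 [RHS]EFinM fineK//.
exact: integrable_fin_num ig.
Qed.

Lemma integrable_test_comp : P.-integrable [set: T] (EFin \o (f \o X)).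
Proof.
have iX := L2_integrable X2.
have ik : P.-integrable [set: T] (EFin \o cst `|f 0|).
  exact: finite_measure_integrable_cst.
have isum := integrableD measurableT ik (integrable_abse iX).
apply: le_integrable isum => //.
  apply/measurable_EFinP; apply: measurableT_comp => //.
  exact: test_measurable.
move=> w _ /=; rewrite lee_fin [leRHS]ger0_norm ?addr_ge0//.
exact: test_linear_growth.
Qed.

(** The weight (x - y)^2 / (2 sigma^2) turns the average of f' over the segment
    into (x - y) (f x - f y) / (2 sigma^2).  Under the product law of two
    copies of X, whose mean is 0, the cross terms vanish and
    2 E[X f(X)] / (2 sigma^2) is left. *)
Lemma square_bias_test :
  (\int[P]_w (X w * f (X w))%:E =
   (sigma ^+ 2)%:E * \int[Q]_w (derive1 f (comb (Xh w) (U w)))%:E)%E.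
Proof.
have mf := test_measurable tf.
have iX := L2_integrable X2; have ifX := integrable_test_comp.
have iXf : P.-integrable [set: T] (EFin \o (fun w => X w * f (X w))).
  exact: integrable_mul_linear_growth X2 mf (test_linear_growth tf).
have [c cE] : exists c, (\int[P]_w (X w * f (X w))%:E = c%:E)%E.
  by exists (fine (\int[P]_w (X w * f (X w))%:E)%E); rewrite fineK//;
    exact: integrable_fin_num iXf.
have [e eE] : exists e, (\int[P]_w ((f \o X) w)%:E = e%:E)%E.
  by exists (fine (\int[P]_w ((f \o X) w)%:E)%E); rewrite fineK//;
    exact: integrable_fin_num ifX.
have EX0 : (\int[P]_w (X w)%:E = 0%:E)%E by move: EX; rewrite unlock.
pose q (z : R * R) := (z.1 - z.2) ^+ 2 / (2 * sigma ^+ 2).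
have q0 z : 0 <= q z by rewrite divr_ge0 ?sqr_ge0// mulr_ge0// ltW.
have mq : measurable_fun [set: R * R] q.
  by apply: measurable_funM => //; apply: measurable_funX; exact: measurable_funB.
pose J (z : R * R) := (z.1 - z.2) * (f z.1 - f z.2) / (2 * sigma ^+ 2).
have mJ : measurable_fun [set: R * R] (EFin \o J).
  apply/measurable_EFinP; apply: measurable_funM => //; apply: measurable_funM.
    exact: measurable_funB.
  by apply: measurable_funB; exact: measurableT_comp.
pose In z : \bar R := (\int[Q]_w (derive1 f (comb z (U w)))%:E)%E.
have In0 z : (0 <= In z)%E.
  by apply: integral_ge0 => w _; rewrite lee_fin test_derive1_ge0.
(* One of the two factors x - y of the weight q turns the average of f' into
   the increment f x - f y. *)
have InJ z : (In z * (q z)%:E = (J z)%:E)%E.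
  rewrite /q /J [in RHS]EFinM -integral_uniform_segment -/(In z).
  by rewrite EFinM muleA (muleC (In z)).
have J0 z : (0 <= (EFin \o J) z)%E by rewrite /= -InJ mule_ge0// lee_fin.
have mg : measurable_fun [set: (R * R) * R]
    (fun x => (derive1 f (comb x.1 x.2))%:E).
  apply/measurable_EFinP.
  exact: measurableT_comp (test_measurable_derive1 tf) measurable_comb.
have g0 x : (0 <= (derive1 f (comb x.1 x.2))%:E :> \bar R)%E.
  by rewrite lee_fin test_derive1_ge0.
have XhU A B : measurable A -> measurable B ->
    (Q (Xh @^-1` A `&` U @^-1` B) = Q (Xh @^-1` A) * Q (U @^-1` B))%E.
  move=> mA mB; rewrite setIC muleC; apply: UXh.
    by exists B => //; rewrite setTI.
  by exists A => //; rewrite setTI.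
have mgz z : measurable_fun [set: R] (fun u => (derive1 f (comb z u))%:E).
  exact: measurableT_comp mg (measurable_pair1 z).
have mIn : measurable_fun [set: R * R] In.
  pose h (x : (R * R) * R) := (derive1 f (comb x.1 x.2))%:E : \bar R.
  have := measurable_fun_fubini_tonelli_F (m2 := distribution Q U) h mg g0.
  congr (measurable_fun _ _); apply/funext => z.
  apply: (ge0_integral_distribution U (mgz z)) => u; exact: (g0 (z, u)).
have -> : (\int[Q]_w (derive1 f (comb (Xh w) (U w)))%:E =
    \int[distribution Q Xh]_z In z)%E.
  rewrite (ge0_independent_expectation XhU mg g0).
  apply: eq_integral => z _; apply: (ge0_integral_distribution U (mgz z)) => u; exact: (g0 (z, u)).
rewrite (ge0_integral_density mq q0 XhE mIn In0).
under [in RHS]eq_integral do rewrite InJ.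
have mX : measurable_fun [set: T] (X : T -> R) by [].
have inner x : (\int[distribution P X]_y (J (x, y))%:E =
    ((x * f x - x * e + c) / (2 * sigma ^+ 2))%:E)%E.
  rewrite (ge0_integral_distribution X (f := fun y => (J (x, y))%:E))//; last 2 first.
    exact: measurableT_comp mJ (measurable_pair1 x).
    by move=> y; exact: J0.
  have := integral_affine3 (x * f x / (2 * sigma ^+ 2)) (- (x / (2 * sigma ^+ 2)))
    (- (f x / (2 * sigma ^+ 2))) (2 * sigma ^+ 2)^-1 ifX iX iXf eE EX0 cE.
  rewrite (_ : _ + _ + _ + _ = (x * f x - x * e + c) / (2 * sigma ^+ 2)); last by ring.
  move=> <-; apply: eq_integral => w _ /=; congr EFin; rewrite /J/=; ring.
rewrite (fubini_tonelli1 (EFin \o J) mJ J0).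
under [in RHS]eq_integral do rewrite /fubini_F inner.
rewrite (ge0_integral_distribution X
  (f := fun x => ((x * f x - x * e + c) / (2 * sigma ^+ 2))%:E)); last 2 first.
- apply/measurable_EFinP; apply: measurable_funM => //; apply: measurable_funD => //.
  by apply: measurable_funB; apply: measurable_funM.
- by move=> x; rewrite -inner; apply: integral_ge0 => y _; exact: J0.
have := integral_affine3 (c / (2 * sigma ^+ 2)) 0 (- (e / (2 * sigma ^+ 2)))
    (2 * sigma ^+ 2)^-1 ifX iX iXf eE EX0 cE.
rewrite (_ : _ + _ + _ + _ = c / sigma ^+ 2); last by field; rewrite gt_eqF.
move=> H; rewrite [X in (_ * X)%E](_ : _ = (c / sigma ^+ 2)%:E); last first.
  by rewrite -H; apply: eq_integral => w _ /=; congr EFin; ring.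
by rewrite cE -EFinM; congr EFin; field; rewrite gt_eqF.
Qed.

End square_bias.

Lemma square_bias_zero_biased (d d' : measure_display)
    (T : measurableType d) (T' : measurableType d') (R : realType)
    (P : probability T R) (Q : probability T' R) (X : {RV P >-> R})
    (sigma : R) (Xh : {RV Q >-> (R * R)%type}) (U : {RV Q >-> R}) :
  (X : T -> R) \in Lfun P 2%:E -> ('E_P[X] = 0)%E ->
  0 < sigma -> ('V_P[X] = (sigma ^+ 2)%:E)%E ->
  (forall A, measurable A ->
    distribution Q Xh A =
    (\int[distribution P X \x distribution P X]_(x in A)
       ((x.1 - x.2) ^+ 2 / (2 * sigma ^+ 2))%:E)%E) ->
  same_law (distribution Q U) (uniform_prob (@ltr01 R)) ->
  independent_events Q (generated_by U) (generated_by Xh) ->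
  zero_biased P X Q (fun w => U w * (Xh w).1 + (1 - U w) * (Xh w).2).
Proof.
move=> X2 EX s0 VX XhE Uunif UXh; set V := (X in zero_biased _ _ _ X).
have mV : measurable_fun [set: T'] V.
  have m1 : measurable_fun [set: T'] (fun w => (Xh w).1).
    exact: measurableT_comp.
  have m2 : measurable_fun [set: T'] (fun w => (Xh w).2).
    exact: measurableT_comp.
  apply: measurable_funD; apply: measurable_funM => //.
  exact: measurable_funB.
have v0 : 0 < sigma ^+ 2 by rewrite exprn_gt0.
pose V' : {RV Q >-> R} := mfun_Sub (mem_set mV).
apply: (has_density_zero_biased X2 EX v0 VX (Ws := V')).
apply: (test_has_density X2 EX v0 VX) => f tf.
exact: (square_bias_test X2 EX s0 XhE Uunif UXh tf).
Qed.

(** * The six properties of the zero bias transformation *)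

Theorem lemma2p1 (R : realType) :
  (* parts 1 to 4 *)
  (forall (d d' : measure_display)
      (T : measurableType d) (T' : measurableType d')
      (P : probability T R) (Q : probability T' R)
      (W : {RV P >-> R}) (Ws : {RV Q >-> R}) (sigma : R),
    (W : T -> R) \in Lfun P 2%:E -> ('E_P[W] = 0)%E ->
    0 < sigma -> ('V_P[W] = (sigma ^+ 2)%:E)%E ->
    zero_biased P W Q Ws ->
    [/\ (* 1 *)
        same_law (distribution Q Ws) (distribution P W) <->
          same_law (distribution P W) (normal_prob 0 sigma),
        (* 2 *)
        [/\ has_density (distribution Q Ws) (zero_bias_density P W),
            unimodal_about0 (zero_bias_density P W),
            law_support (distribution Q Ws) =
              closed_convex_hull (law_support (distribution P W)) &
            as_bounded P W -> as_bounded Q Ws],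
        (* 3 *)
        symmetric_law (distribution P W) ->
          symmetric_law (distribution Q Ws) &
        (* 4 *)
        forall n : nat, (1 <= n)%N ->
          P.-integrable [set: T] (fun w => (W w ^+ (n + 2))%:E) ->
          Q.-integrable [set: T'] (fun w => (Ws w ^+ n)%:E) /\
          ((sigma ^+ 2)%:E * 'E_Q[fun w => (Ws w ^+ n)%R] =
           'E_P[fun w => (W w ^+ (n + 2))%R] * ((n + 1)%:R^-1)%:E)%E]) /\
  (* part 5 *)
  (forall (d : measure_display) (T : measurableType d) (P : probability T R)
      (n : nat) (X : 'I_n -> {RV P >-> R}) (sigma : 'I_n -> R)
      (Xs : 'I_n -> {RV P >-> R}) (I : T -> 'I_n),
    let W := fun w => \sum_(i < n) X i w in
    let sigma2 := \sum_(i < n) sigma i ^+ 2 in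
    mutually_independent P X ->
    (forall i, (X i : T -> R) \in Lfun P 2%:E) -> (forall i, 'E_P[X i] = 0)%E ->
    (forall i, 'E_P[fun w => (X i w ^+ 2)%R] = (sigma i ^+ 2)%:E)%E ->
    0 < sigma2 ->
    (forall i, 0 < sigma i ^+ 2 -> zero_biased P (X i) P (Xs i)) ->
    (forall i, 0 < sigma i ^+ 2 ->
      independent_events P (generated_by (Xs i))
        (family_generated_by [set j | j != i] X)) ->
    (forall i, measurable (I @^-1` [set i])) ->
    independent_events P [set I @^-1` S | S in [set: set 'I_n]]
      <<s family_generated_by [set: 'I_n] X `|`
          family_generated_by [set j | 0 < sigma j ^+ 2] Xs >> ->
    (forall i, P (I @^-1` [set i]) = (sigma i ^+ 2 / sigma2)%:E) ->
    ('E_P[fun w => (W w ^+ 2)%R] = sigma2%:E)%E /\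
    zero_biased P W P
      (fun w => \sum_(j < n | j != I w) X j w + Xs (I w) w)) /\
  (* part 6 *)
  (forall (d d' : measure_display)
      (T : measurableType d) (T' : measurableType d')
      (P : probability T R) (Q : probability T' R) (X : {RV P >-> R})
      (sigma : R) (Xh : {RV Q >-> (R * R)%type}) (U : {RV Q >-> R}),
    (X : T -> R) \in Lfun P 2%:E -> ('E_P[X] = 0)%E ->
    0 < sigma -> ('V_P[X] = (sigma ^+ 2)%:E)%E ->
    (forall A, measurable A ->
      distribution Q Xh A =
      (\int[distribution P X \x distribution P X]_(x in A)
         ((x.1 - x.2) ^+ 2 / (2 * sigma ^+ 2))%:E)%E) ->
    same_law (distribution Q U) (uniform_prob (@ltr01 R)) ->
    independent_events Q (generated_by U) (generated_by Xh) ->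
    zero_biased P X Q
      (fun w => U w * (Xh w).1 + (1 - U w) * (Xh w).2)).
Proof.
split; [|split].
- move=> d d' T T' P Q W Ws sigma W2 EW s0 VW zb.
  have v0 : 0 < sigma ^+ 2 by rewrite exprn_gt0.
  have D := zero_biased_has_density W2 EW v0 VW zb.
  split.
  + split => [same|WN A mA].
      apply: (zero_bias_density_fixed_normal W2 EW s0 VW).
      have [mp p0 pE] := D; split => // A mA.
      by rewrite -same// pE.
    have [_ _ ->//] := D.
    by rewrite (zero_bias_density_normal W2 EW s0 VW WN) WN.
  + split => //.
    * exact: zero_bias_density_unimodal W2 EW v0 VW.
    * exact: zero_biased_support W2 EW v0 VW _ _ _ _ D.
    * exact: zero_biased_bounded W2 EW v0 VW _ _ _ _ D.
  + exact: zero_biased_symmetric W2 EW v0 VW _ _ _ _ zb.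
  + move=> n _ iW; have [iWs E] := zero_biased_moment W2 EW v0 VW zb iW.
    by split.
- move=> d T P n X sigma Xs I W sigma2 indX X2 EX EX2 v0 zb indXs mI indI PI.
  split; first exact: (expectation_sum_sqr indX X2 EX EX2 zb indXs).
  exact: (random_replacement_zero_biased indX X2 EX EX2 v0 zb indXs mI indI PI).
- move=> d d' T T' P Q X sigma Xh U X2 EX s0 VX XhE Uunif UXh.
  exact: square_bias_zero_biased X2 EX s0 VX XhE Uunif UXh.
Qed.
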